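(* Let $A \in \mathbb{R}^{m\times n}$ with $\operatorname{rank}A = n$, $b\in\mathbb{R}^m$, and let $\mathcal{P}=\{x\in\mathbb{R}^n\colon Ax\le b\}$ be a pointed $n$-dimensional polyhedron whose inequalities are all facet-defining. Let $\Delta=\Delta(A)$ and $\Delta_{\min}=\Delta_{\min}(\mathcal{P},A)$. Then the graph $\mathcal{G}(\mathcal{P})$ satisfies $$\operatorname{diam}\bigl(\mathcal{G}(\mathcal{P})\bigr) = O\!\left(n^3\cdot\frac{\Delta}{\Delta_{\min}}\cdot\ln\Bigl(n\frac{\Delta}{\Delta_{\min}}\Bigr)\right),$$ with an absolute constant in the $O(\cdot)$.
   Context: $\mathcal{G}(\mathcal{P})$ is the graph formed by the vertices and edges ($1$-skeleton) of $\mathcal{P}$. $\Delta(A)$ is the maximum of $|\det A_{\mathcal{B}}|$ over $n$-element row index sets $\mathcal{B}$. For a vertex $v$, its normal cone is $\operatorname{cone}(A_{i*}^\top\colon A_{i*}v=b_i)$; the normal fan consists of these cones and their faces. A triangulation $\mathcal{T}$ of the normal fan partitions each $n$-dimensional normal cone into $n$-dimensional simplicial cones generated by $n$ of the vectors $A_{i*}^\top$ with $A_{i*}v=b_i$, forming a fan; each is identified with its row index set $\mathcal{B}$. $\Delta_{\min}(\mathcal{P},A)=\max_{\mathcal{T}}\min_{\mathcal{B}\in\mathcal{T}}|\det A_{\mathcal{B}}|$ over all triangulations $\mathcal{T}$.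
   Formalization: The O(f) bound is read as diam ≤ C·max(1, f) with f = n³(Δ/Δ_min)ln(nΔ/Δ_min), because for n = 1 a segment has diameter 1 while f can be 0; for n ≥ 2 one has f > 1, so the bound is diam ≤ C·f as stated. *)

(* Defs.v *)
From HB Require Import structures.
From mathcomp Require Import all_boot all_order all_algebra.
From mathcomp Require Import boolp classical_sets reals exp.
Set Implicit Arguments. Unset Strict Implicit. Unset Printing Implicit Defensive.
Import Order.TTheory GRing.Theory Num.Theory.
Local Open Scope ring_scope.
Local Open Scope classical_set_scope.

Section Polyhedra.
Variables (R : realType) (m n : nat) (A : 'M[R]_(m, n)) (b : 'cV[R]_m).

Definition poly : set 'cV[R]_n :=
  [set x | forall i : 'I_m, (A *m x) i 0 <= b i 0].

Definition tight_face (I : {set 'I_m}) : set 'cV[R]_n :=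
  [set x | poly x /\ forall i, i \in I -> (A *m x) i 0 = b i 0].

Definition is_face (F : set 'cV[R]_n) : Prop :=
  F !=set0 /\ exists I : {set 'I_m}, F = tight_face I.

(** S has affine dimension at least k: it contains k+1 affinely
    independent points x0, x0 + X_1, ..., x0 + X_k *)
Definition affdim_ge (S : set 'cV[R]_n) (k : nat) : Prop :=
  exists (x0 : 'cV[R]_n) (X : 'M[R]_(n, k)),
    S x0 /\ (forall j : 'I_k, S (x0 + col j X)) /\ \rank X = k.

Definition affdim_eq (S : set 'cV[R]_n) (k : nat) : Prop :=
  affdim_ge S k /\ ~ affdim_ge S k.+1.

Definition full_dimensional : Prop := affdim_eq poly n.

Definition is_facet (F : set 'cV[R]_n) : Prop :=
  is_face F /\ affdim_eq F n.-1.

Definition all_facet_defining : Prop :=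
  forall i : 'I_m, is_facet (tight_face [set i]).

Definition is_vertex (v : 'cV[R]_n) : Prop := is_face [set v].

Definition pointed : Prop := exists v, is_vertex v.

Definition segment (u v : 'cV[R]_n) : set 'cV[R]_n :=
  [set x | exists t : R, 0 <= t <= 1 /\ x = (1 - t) *: u + t *: v].

Definition adjacent (u v : 'cV[R]_n) : Prop :=
  is_vertex u /\ is_vertex v /\ u <> v /\ is_face (segment u v).

Inductive walk : nat -> 'cV[R]_n -> 'cV[R]_n -> Prop :=
| walk0 u : walk 0 u u
| walkS k u w v : adjacent u w -> walk k w v -> walk k.+1 u v.

Definition diam_le (X : R) : Prop :=
  forall u v, is_vertex u -> is_vertex v ->
    exists k : nat, walk k u v /\ (k%:R <= X).

(** |det A_B| for a row index set B (0 unless #|B| = n); independent of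
    the ordering of B, realized by any bijection 'I_n -> B *)
Definition absdet (B : {set 'I_m}) : R :=
  \big[Num.max/0]_(f : {ffun 'I_n -> 'I_m} | f @: setT == B)
     `|\det (rowsub f A)|.

Definition Delta : R :=
  \big[Num.max/0]_(B : {set 'I_m} | #|B| == n) absdet B.

Definition tight_set (x : 'cV[R]_n) : {set 'I_m} :=
  [set i | (A *m x) i 0 == b i 0].

Definition rcone (S : {set 'I_m}) : set 'rV[R]_n :=
  [set y | exists lam : 'I_m -> R, (forall i, 0 <= lam i) /\
     (forall i, i \notin S -> lam i = 0) /\
     y = \sum_(i < m) lam i *: row i A].

Definition cone_face (K F : set 'rV[R]_n) : Prop :=
  exists c : 'cV[R]_n, (forall y, K y -> (y *m c) 0 0 <= 0) /\
    F = K `&` [set y | (y *m c) 0 0 = 0].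

(** T is a triangulation of the normal fan of P: every B in T indexes n
    linearly independent rows that are tight at some vertex; for each
    vertex v, the normal cone cone(A_i : A_i v = b_i) is the union of the
    simplicial cones cone(A_B), B in T, B tight at v; and the cones form
    a fan (pairwise intersections are common faces). *)
Definition triangulation (T : {set {set 'I_m}}) : Prop :=
  [/\ forall B, B \in T -> absdet B != 0 /\
        exists v, is_vertex v /\ B \subset tight_set v,
      forall v, is_vertex v ->
        rcone (tight_set v) =
        \bigcup_(B in [set B | B \in T /\ B \subset tight_set v]) rcone B
    & forall B B', B \in T -> B' \in T ->
        cone_face (rcone B) (rcone B `&` rcone B') /\
        cone_face (rcone B') (rcone B `&` rcone B')].

Definition tri_min (T : {set {set 'I_m}}) : R :=
  \big[Num.min/Delta]_(B in T) absdet B.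

Definition Delta_min : R :=
  \big[Num.max/0]_(T : {set {set 'I_m}} | `[< triangulation T >]) tri_min T.

End Polyhedra.

(* Main.v *)
(** Write kappa = Delta / Delta_min.  In the coordinates given by [n] rows of
    maximal determinant all rows have entries in [-1, 1], and every vertex [v] has
    [n] tight rows in which every row of [A] has coordinates at most kappa in
    absolute value; hence the sum of these [n] rows lies deep inside the normal
    cone of [v].

    Following the optimal vertex of an objective that moves along a segment gives
    a walk whose length is at most the number of normal cones that the segment
    meets.  To join [u] to [v], let [c_u], [c_v] be the sums of the tight rows at
    [u] and [v] as above, and move from [alpha c_u + X] to [X] and then to
    [alpha c_v + X], for a large [alpha] and a point [X] of a shifted lattice in
    the cone of all rows.  Cut this path into short segments.  Shifting [X] by a
    suitable lattice vector deep inside a normal cone turns "the segment meets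
    the cone" into "its endpoint lies in the cone", and a generic endpoint lies
    in only one cone; so the average number of cones met by one short segment,
    over all lattice points [X] in a ball, is at most the growth of the number of
    lattice points under a slight enlargement of the ball, which is at most 3 for
    a suitable radius.  The segments can be chosen geometrically growing in
    [alpha], so that O(n^2 kappa ln (n kappa)) of them suffice.

    That Delta_min is positive, i.e., that the normal fan has a triangulation,
    follows by perturbing [b] to make the polyhedron simple. *)

Require Import Defs.
From HB Require Import structures.
From mathcomp Require Import all_boot all_order all_algebra.
From mathcomp Require Import boolp classical_sets reals exp.
From mathcomp Require Import ring lra.
Set Implicit Arguments.
Unset Strict Implicit.
Unset Printing Implicit Defensive.
Import Order.TTheory GRing.Theory Num.Theory.
Local Open Scope ring_scope.

Local Notation poly := Defs.poly.

(** * Polyhedra, optimal points and vertices *)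

(** The step length of the simplex method: the least ratio [s i / a i] over the [i] with
    [a i > 0]. *)
Lemma ratio_test (R : realFieldType) (I : finType) (P : pred I) (a s : I -> R) :
  (forall i, P i -> 0 <= s i) -> (exists2 i, P i & 0 < a i) ->
  exists2 t, 0 <= t & (forall i, P i -> t * a i <= s i) /\
    exists i, [/\ P i, 0 < a i & t * a i = s i].
Proof.
move=> s0 [i0 Pi0 ai0].
have Q0 : [pred i | P i && (0 < a i)] i0 by rewrite /= Pi0.
case: (arg_minP (fun i => s i / a i) Q0) => i /andP[Pi ai] imin.
exists (s i / a i); first by rewrite divr_ge0 ?s0 // ltW.
split; last by exists i; split=> //; rewrite divfK // gt_eqF.
move=> j Pj; have [aj|aj] := ltP 0 (a j).
  by rewrite -ler_pdivlMr //; apply: imin; rewrite inE Pj.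
apply: le_trans (s0 _ Pj); apply: mulr_ge0_le0 => //.
by rewrite divr_ge0 ?s0 // ltW.
Qed.

Lemma small_step (R : realFieldType) (I : finType) (P : pred I) (a s : I -> R) :
  (forall i, P i -> 0 < s i) ->
  exists2 t, 0 < t & forall i, P i -> t * a i < s i.
Proof.
move=> s0.
have [/existsP[i0 /andP[Pi0 ai0]]|nex] :=
  boolP [exists i, P i && (0 < a i)].
  have [||t t0 [tP [i [Pi ai ti]]]] := @ratio_test R I P a s.
  - by move=> i /s0 /ltW.
  - by exists i0.
  have tp : 0 < t by rewrite -(pmulr_lgt0 _ ai) ti s0.
  exists (t / 2); first by rewrite divr_gt0.
  move=> j Pj; have := tP _ Pj; have := s0 _ Pj; nra.
exists 1 => // i Pi; rewrite mul1r; apply: le_lt_trans (s0 _ Pi).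
by move: nex => /existsPn/(_ i); rewrite Pi -leNgt.
Qed.

Definition dot {R : realType} {n : nat} (r : 'rV[R]_n) (x : 'cV[R]_n) : R :=
  (r *m x) 0 0.

Section Dot.
Variables (R : realType) (n : nat).
Implicit Types (r : 'rV[R]_n) (x : 'cV[R]_n).

Lemma dotDl r r' x : dot (r + r') x = dot r x + dot r' x.
Proof. by rewrite /dot mulmxDl mxE. Qed.
Lemma dotDr r x y : dot r (x + y) = dot r x + dot r y.
Proof. by rewrite /dot mulmxDr mxE. Qed.
Lemma dotZl a r x : dot (a *: r) x = a * dot r x.
Proof. by rewrite /dot -scalemxAl mxE. Qed.
Lemma dotZr a r x : dot r (a *: x) = a * dot r x.
Proof. by rewrite /dot -scalemxAr mxE. Qed.
Lemma dotNl r x : dot (- r) x = - dot r x.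
Proof. by rewrite /dot mulNmx mxE. Qed.
Lemma dotNr r x : dot r (- x) = - dot r x.
Proof. by rewrite /dot mulmxN mxE. Qed.
Lemma dot_suml (I : finType) (F : I -> 'rV[R]_n) x :
  dot (\sum_i F i) x = \sum_i dot (F i) x.
Proof. by rewrite /dot mulmx_suml summxE. Qed.
Lemma dot0l x : dot 0 x = 0.
Proof. by rewrite /dot mul0mx mxE. Qed.
Lemma dot0r r : dot r 0 = 0.
Proof. by rewrite /dot mulmx0 mxE. Qed.
Definition dotE := (dotDl, dotDr, dotZl, dotZr, dotNl, dotNr).

Lemma dot_row (m : nat) (A : 'M[R]_(m, n)) i x : (A *m x) i 0 = dot (row i A) x.
Proof. by rewrite /dot -row_mul [RHS]mxE. Qed.

End Dot.

Section Polyhedron.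
Variables (R : realType) (m n : nat) (A : 'M[R]_(m, n)) (b : 'cV[R]_m).
Implicit Types (r p q d : 'rV[R]_n) (x y u v w : 'cV[R]_n).

Let a i x : R := dot (row i A) x.

Lemma in_polyP x : poly A b x <-> forall i, a i x <= b i 0.
Proof. by split=> + i => /(_ i); rewrite dot_row. Qed.

Lemma in_tight_set x i : (i \in tight_set A b x) = (a i x == b i 0).
Proof. by rewrite inE dot_row. Qed.

Lemma feasible_direction v y : poly A b v ->
  (forall i, i \in tight_set A b v -> a i y <= 0) ->
  exists2 t, 0 < t & poly A b (v + t *: y).
Proof.
move=> /in_polyP Pv ty.
have [i it|t t0 tP] := @small_step R _ [pred i | i \notin tight_set A b v]
  (fun i => a i y) (fun i => b i 0 - a i v).
  by rewrite subr_gt0 lt_neqAle Pv andbT -in_tight_set.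
exists t => //; apply/in_polyP => i; rewrite /a !dotE -/(a i v) -/(a i y).
have [it|it] := boolP (i \in tight_set A b v).
  have := ty _ it; move: it; rewrite in_tight_set => /eqP ->; nra.
by have := tP _ it; lra.
Qed.

(** A vector killed by all tight rows can be followed a little inside every face containing [v], so
    at a vertex it is zero; the converse uses the face of all inequalities tight at [v]. *)
Lemma vertexP v : is_vertex A b v <-> poly A b v /\
  forall y, (forall i, i \in tight_set A b v -> a i y = 0) -> y = 0.
Proof.
split=> [[_ [I vI]]|[Pv ker]].
  have tv : tight_face A b I v by rewrite -vI.
  split=> [|y yt]; first by case: tv.
  have [|t t0 Pt] := @feasible_direction v y tv.1.
    by move=> i /yt ->.
  have : (tight_face A b I) (v + t *: y).
    split=> // i iI; rewrite dot_row !dotE -/(a i y) yt.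
      by rewrite mulr0 addr0 -dot_row tv.2.
    by rewrite in_tight_set /a -dot_row tv.2.
  rewrite -vI => /= /(congr1 (fun z => z - v)).
  rewrite addrAC subrr add0r => /eqP.
  by rewrite scaler_eq0 gt_eqF //= => /eqP.
split; first by exists v.
exists (tight_set A b v); apply/seteqP; split=> [x ->|x [Px xt]].
  by split=> // i; rewrite in_tight_set /a -dot_row => /eqP.
apply/eqP; rewrite -subr_eq0; apply/eqP/ker => i iv.
rewrite /a !dotE -[dot _ x]dot_row xt //.
by move: iv; rewrite in_tight_set => /eqP; rewrite /a => ->; rewrite subrr.
Qed.

Lemma tight_set_inj u v : is_vertex A b u -> is_vertex A b v ->
  tight_set A b u = tight_set A b v -> u = v.
Proof.
move=> /vertexP[_ ku] _ uv; apply/eqP; rewrite -subr_eq0; apply/eqP/ku => i iu.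
rewrite /a !dotE; have iv := iu; rewrite uv in iv.
move: iu iv; rewrite !in_tight_set => /eqP iu /eqP iv.
by apply/eqP; rewrite subr_eq0; apply/eqP; rewrite -/(a i u) -/(a i v) iu iv.
Qed.

(** For a vertex [v] this is membership of [r] in the normal cone of [v], by linear programming
    duality. *)
Definition opt r v := poly A b v /\ forall x, poly A b x -> dot r x <= dot r v.

Definition bounded r := exists K : R, forall x, poly A b x -> dot r x <= K.

Lemma opt_bounded r v : opt r v -> bounded r.
Proof. by move=> [_ ov]; exists (dot r v). Qed.

Lemma boundedD r r' : bounded r -> bounded r' -> bounded (r + r').
Proof.
move=> [K hK] [K' hK']; exists (K + K') => x Px.
by rewrite dotDl lerD ?hK ?hK'.
Qed.

Lemma boundedZ t r : 0 <= t -> bounded r -> bounded (t *: r).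
Proof.
by move=> t0 [K hK]; exists (t * K) => x Px; rewrite dotZl ler_wpM2l ?hK.
Qed.

Lemma optD r r' v : opt r v -> opt r' v -> opt (r + r') v.
Proof. by move=> [Pv ov] [_ ov']; split=> // x Px; rewrite !dotDl lerD ?ov ?ov'. Qed.

Lemma optZ t r v : 0 <= t -> opt r v -> opt (t *: r) v.
Proof. by move=> t0 [Pv ov]; split=> // x Px; rewrite !dotZl ler_wpM2l ?ov. Qed.

Lemma opt_row i v : poly A b v -> i \in tight_set A b v -> opt (row i A) v.
Proof.
by move=> Pv; rewrite in_tight_set => /eqP iv; split=> // x /in_polyP/(_ i); rewrite -iv.
Qed.

Lemma opt_sum (I : finType) (F : I -> 'rV[R]_n) v : poly A b v ->
  (forall i, opt (F i) v) -> opt (\sum_i F i) v.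
Proof.
move=> Pv oF; split=> // x Px; rewrite !dot_suml ler_sum // => i _.
exact: (oF i).2.
Qed.

Lemma opt_of_eq r u v : opt r u -> poly A b v -> dot r v = dot r u -> opt r v.
Proof. by move=> [_ ou] Pv e; split=> // x /ou; rewrite e. Qed.

Lemma dot_opt r u v : opt r u -> opt r v -> dot r u = dot r v.
Proof. by move=> [Pu ou] [Pv ov]; apply: le_anti; rewrite ov ?ou. Qed.

Lemma opt_direction r u y : opt r u ->
  (forall i, i \in tight_set A b u -> a i y <= 0) -> dot r y <= 0.
Proof.
move=> [Pu ou] /(feasible_direction Pu)[t t0 /ou].
by rewrite !dotE gerDl pmulr_rle0.
Qed.

Lemma ratio_step x y : poly A b x -> (exists i, 0 < a i y) ->
  exists2 t, 0 <= t & poly A b (x + t *: y) /\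
    exists i, 0 < a i y /\ i \in tight_set A b (x + t *: y).
Proof.
move=> /in_polyP Px [i0 ai0].
have [||t t0 [tP [i [_ ai ti]]]] := @ratio_test R _ predT
  (fun i => a i y) (fun i => b i 0 - a i x).
- by move=> i _; rewrite subr_ge0.
- by exists i0.
exists t => //; split.
  apply/in_polyP => j; have := tP j isT.
  by rewrite /a !dotE -/(a j x) -/(a j y); lra.
exists i; split=> //; rewrite in_tight_set /a !dotE -/(a i x) -/(a i y) ti.
by apply/eqP; ring.
Qed.

Hypothesis rankA : \rank A = n.

Lemma ker_full (k : nat) (M : 'M[R]_(k, n)) y : \rank M = n -> M *m y = 0 -> y = 0.
Proof.
move=> rM My; apply: trmx_inj; rewrite trmx0.
apply: (@row_free_inj _ _ _ _ M^T); first by rewrite /row_free mxrank_tr rM.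
by rewrite mul0mx -trmx_mul My trmx0.
Qed.

Lemma row_ker y : (forall i, a i y = 0) -> y = 0.
Proof.
move=> ay; apply: (@ker_full _ A) => //; apply/matrixP => i j.
by rewrite ord1 dot_row -/(a i y) ay mxE.
Qed.

(** A point that is not a vertex can move along a line on which its tight rows are constant, without
    decreasing [r], until a new inequality becomes tight. The induction is on the number of
    inequalities that are not tight. *)
Lemma purify r x : bounded r -> poly A b x ->
  exists2 v, is_vertex A b v & dot r x <= dot r v.
Proof.
move=> br; have [k] := ubnP (m - #|tight_set A b x|)%N.
elim: k => // k IH in x *; rewrite ltnS => hk Px.
have [vx|] := pselect (is_vertex A b x); first by exists x.
move=> /vertexP nv.
have [y [yt yn0]] : exists y,
    (forall i, i \in tight_set A b x -> a i y = 0) /\ y <> 0.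
  apply: contrapT => ny; apply: nv; split=> // y yt; apply: contrapT => y0.
  by apply: ny; exists y.
have step z : (forall i, i \in tight_set A b x -> a i z = 0) ->
    0 <= dot r z -> (exists i, 0 < a i z) ->
    exists2 v, is_vertex A b v & dot r x <= dot r v.
  move=> zt rz az; have [t t0 [Pt [i [ai it]]]] := ratio_step Px az.
  have sub : tight_set A b x \proper tight_set A b (x + t *: z).
    apply/fintype.properP; split.
      apply/fintype.subsetP => j jx; have := jx.
      rewrite !in_tight_set /a !dotE => /eqP ->.
      by rewrite -/(a j z) zt // mulr0 addr0.
    by exists i => //; apply: contraL ai => /zt ->; rewrite ltxx.
  have [|v vv xv] := IH (x + t *: z) _ Pt.
    apply: leq_trans hk; rewrite ltn_sub2l ?proper_card //.
    by apply: leq_trans (proper_card sub) _; rewrite -[X in (_ <= X)%N]card_ord max_card.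
  exists v => //; apply: le_trans xv; rewrite !dotE lerDl.
  exact: mulr_ge0.
wlog ry : y yt yn0 / 0 <= dot r y.
  move=> W; have [ry|ry] := leP 0 (dot r y); first exact: (W y).
  apply: (W (- y)).
  - by move=> i /yt; rewrite /a dotNr => ->; rewrite oppr0.
  - by move=> /eqP; rewrite oppr_eq0 => /eqP.
  - by rewrite dotNr oppr_ge0 ltW.
have [ay|nay] := pselect (exists i, 0 < a i y); first exact: (step y).
have ay i : a i y <= 0 by rewrite leNgt; apply/negP => ai; apply: nay; exists i.
(* An unblocked [y] is a recession direction, so boundedness makes [r] constant along it; then [- y]
   serves instead, being blocked because rank [n] excludes lines. *)
have ry0 : dot r y = 0.
  apply: le_anti; rewrite ry andbT leNgt; apply/negP => ryp.
  have [K hK] := br; have := hK x Px => xK.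
  have /hK : poly A b (x + ((K - dot r x + 1) / dot r y) *: y).
    apply/in_polyP => i; rewrite /a !dotE; move/in_polyP: Px => /(_ i).
    have := ay i; rewrite /a.
    have : 0 <= (K - dot r x + 1) / dot r y by rewrite divr_ge0 //; lra.
    set t := _ / _; nra.
  by rewrite !dotE divfK ?gt_eqF //; lra.
apply: (step (- y)).
- by move=> i /yt; rewrite /a dotNr => ->; rewrite oppr0.
- by rewrite dotNr ry0 oppr0.
apply: contrapT => ny; apply: yn0; apply: row_ker => i.
apply: le_anti; rewrite ay leNgt; apply/negP => ai; apply: ny; exists i.
by rewrite /a dotNr oppr_gt0.
Qed.

(** Indexing vertices by tight sets makes extrema and counts over vertices finite; the value is 0
    when no vertex has tight set [I]. *)
Definition vert (I : {set 'I_m}) : 'cV[R]_n :=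
  xget 0 [set v | is_vertex A b v /\ tight_set A b v = I]%classic.

Lemma vertK v : is_vertex A b v -> vert (tight_set A b v) = v.
Proof.
move=> vv; rewrite /vert; case: xgetP => [w _ [vw tw]|/(_ v)]; last by case.
exact: tight_set_inj tw.
Qed.

Lemma opt_vertex r x : poly A b x -> bounded r ->
  exists2 v, is_vertex A b v & opt r v.
Proof.
move=> Px br; have [v0 vv0 _] := purify br Px.
have Q0 : [pred I | `[< is_vertex A b (vert I) >]] (tight_set A b v0).
  by apply/asboolP; rewrite vertK.
case: (arg_maxP (fun I => dot r (vert I)) Q0) => I /asboolP vI Imax.
exists (vert I) => //; split; first by case/vertexP: vI.
move=> y Py; have [v vv yv] := purify br Py.
apply: le_trans yv _; rewrite -(vertK vv); apply: Imax.
by apply/asboolP; rewrite vertK.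
Qed.

Lemma opt_vertices r u : bounded r -> poly A b u ->
  (forall v, is_vertex A b v -> dot r v <= dot r u) -> opt r u.
Proof.
move=> br Pu ru; have [v vv [Pv ov]] := opt_vertex Pu br.
by split=> // x /ov xv; apply: le_trans xv (ru _ vv).
Qed.

End Polyhedron.

(** * Walks along a moving objective *)

Section Walks.
Variables (R : realType) (m n : nat) (A : 'M[R]_(m, n)) (b : 'cV[R]_m).
Implicit Types (r p q d : 'rV[R]_n) (x y u v w g : 'cV[R]_n).

Let a i x : R := dot (row i A) x.

Let zeros u g := [set i in tight_set A b u | a i g == 0].

(** Enlarging the set of tight rows that vanish on [g], as long as they leave more than the line of
    [g], ends in the direction of an edge at [u]. *)
Lemma extreme_direction r d u g : is_vertex A b u -> opt A b r u ->
  (forall i, i \in tight_set A b u -> a i g <= 0) -> dot r g = 0 -> 0 < dot d g ->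
  exists h, [/\ forall i, i \in tight_set A b u -> a i h <= 0, dot r h = 0,
    0 < dot d h & forall y, (forall i, i \in zeros u h -> a i y = 0) ->
      exists l, y = l *: h].
Proof.
move=> vu ou; have [Pu ku] := (vertexP _ _ _).1 vu.
have [k] := ubnP (m - #|zeros u g|)%N.
elim: k => // k IH in g *; rewrite ltnS => hk tg rg dg.
have [ext|next] := pselect (forall y, (forall i, i \in zeros u g -> a i y = 0) ->
  exists l, y = l *: g); first by exists g.
have [y [yz yg]] : exists y, (forall i, i \in zeros u g -> a i y = 0) /\
    forall l, y <> l *: g.
  apply: contrapT => ny; apply: next => y yz; apply: contrapT => yl.
  by apply: ny; exists y; split=> // l e; apply: yl; exists l.
(* The correction by a multiple of [g] makes [d] vanish on [z], so moves along [z] keep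
   [dot d g]. *)
pose z := y - (dot d y / dot d g) *: g.
have dz : dot d z = 0 by rewrite !dotE divfK ?gt_eqF // subrr.
have zz i : i \in zeros u g -> a i z = 0.
  move=> iz; have := yz _ iz; rewrite /a !dotE => ->.
  by move: iz; rewrite inE => /andP[_ /eqP]; rewrite /a => ->; rewrite mulr0 subrr.
have zn0 : z <> 0.
  by move=> /eqP; rewrite subr_eq0 => /eqP; apply: yg.
clearbody z.
(* A small step from [g] along any multiple of [z] remains a feasible direction at [u]; using both
   signs, optimality of [u] gives [dot r z = 0]. *)
have small e : dot r (e *: z) <= 0.
  have [i /andP[iu iz]|t t0 tP] := @small_step R _
    [pred i | (i \in tight_set A b u) && (a i g != 0)]
    (fun i => a i (e *: z)) (fun i => - a i g).
    by rewrite oppr_gt0 lt_neqAle iz tg.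
  have : dot r (g + t *: (e *: z)) <= 0.
    apply: opt_direction ou _ => i iu; rewrite dotDr dotZr -/(a i g) -/(a i _).
    have [iz|iz] := eqVneq (a i g) 0.
      have := zz i; rewrite inE iu iz eqxx /= /a dotZr => ->//.
      by rewrite !mulr0 addr0.
    by have := tP i; rewrite /= iu iz => /(_ isT); lra.
  by rewrite dotDr rg add0r (dotZr t) pmulr_rle0.
have rz : dot r z = 0.
  apply: le_anti; have := small 1; have := small (-1).
  by rewrite !dotE => h1 h2; apply/andP; split; lra.
have [s [s1 [i iu siz]]] : exists s : R, s != 0 /\
    exists2 i, i \in tight_set A b u & 0 < a i (s *: z).
  have [i [iu iz]] : exists i, i \in tight_set A b u /\ a i z != 0.
    apply: contrapT => nz; apply: zn0; apply: ku => i iu.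
    by apply/eqP/negPn/negP => iz; apply: nz; exists i.
  exists (a i z); split=> //; exists i => //.
  by rewrite /a dotZr -/(a i z) -expr2 exprn_even_gt0.
have [||t t0 [tP [j [ju aj tj]]]] := @ratio_test R _ (mem (tight_set A b u))
  (fun i => a i (s *: z)) (fun i => - a i g).
- by move=> l lu; rewrite oppr_ge0 tg.
- by exists i.
have sub : zeros u g \proper zeros u (g + t *: (s *: z)).
  apply/fintype.properP; split.
    apply/fintype.subsetP => l lz; have := lz; rewrite !inE => /andP[-> /eqP].
    by rewrite /a !dotE => ->; rewrite -/(a l z) zz // !mulr0 addr0 eqxx.
  exists j; first by rewrite inE (ju : j \in _) /a dotDr dotZr -/(a j g) -/(a j _) tj subrr eqxx.
  by apply: contraL aj => /zz; rewrite /a dotZr => ->; rewrite mulr0 ltxx.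
apply: (IH (g + t *: (s *: z))).
- apply: leq_trans hk; rewrite ltn_sub2l ?proper_card //.
  by apply: leq_trans (proper_card sub) _; rewrite -[X in (_ <= X)%N]card_ord max_card.
- by move=> l lu; have := tP l lu; rewrite /a dotDr (dotZr t); lra.
- by rewrite !dotE rg rz !mulr0 addr0.
- by rewrite !dotE dz !mulr0 addr0.
Qed.

(** A simplex step inside the optimal face of [r]: an edge direction at [u] on which [d] grows is
    followed to its end, which exists because [d] is bounded on that face. *)
Lemma pivot r d u x : is_vertex A b u -> opt A b r u -> opt A b r x ->
  dot d u < dot d x ->
  (exists K, forall y, opt A b r y -> dot d y <= K) ->
  exists w, [/\ adjacent A b u w, is_vertex A b w, opt A b r w & dot d u < dot d w].
Proof.
move=> vu ou ox dux [K hK]; have [Pu ku] := (vertexP _ _ _).1 vu.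
have [|||h [th rh dh ext]] := @extreme_direction r d u (x - u) vu ou.
- move=> i iu; rewrite /a !dotE subr_le0.
  move: iu; rewrite in_tight_set => /eqP ->; by have /in_polyP := ox.1.
- by rewrite !dotE (dot_opt ou ox) subrr.
- by rewrite !dotE subr_gt0.
have hn0 : h <> 0 by move=> h0; move: dh; rewrite h0 dot0r ltxx.
have optr t : poly A b (u + t *: h) -> opt A b r (u + t *: h).
  by move=> Pt; apply: opt_of_eq ou Pt _; rewrite !dotE rh mulr0 addr0.
have [|t t0 [Pt [j [aj jt]]]] := @ratio_step _ _ _ A b u h Pu.
  apply: contrapT => na.
  have ah i : a i h <= 0 by rewrite leNgt; apply/negP => ai; apply: na; exists i.
  have uK := hK _ ou.
  have /optr/hK : poly A b (u + ((K - dot d u + 1) / dot d h) *: h).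
    apply/in_polyP => i; rewrite !dotE; have /in_polyP/(_ i) := Pu.
    have := ah i; rewrite /a.
    have : 0 <= (K - dot d u + 1) / dot d h by rewrite divr_ge0 //; lra.
    set t := _ / _; nra.
  by rewrite !dotE divfK ?gt_eqF //; lra.
have ju : j \notin tight_set A b u by apply: contraL aj => /th; rewrite ltNge => ->.
have tp : 0 < t.
  rewrite lt_neqAle t0 andbT; apply: contraNneq ju => t0'.
  by move: jt; rewrite -t0' scale0r addr0.
pose w := u + t *: h.
have zw i : i \in zeros u h -> i \in tight_set A b w.
  rewrite inE !in_tight_set => /andP[/eqP e /eqP]; rewrite /a /w !dotE e => ->.
  by rewrite mulr0 addr0.
have vw : is_vertex A b w.
  apply/vertexP; split=> // y yw.
  have [|l yl] := ext y; first by move=> i /zw /yw.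
  have := yw j jt; rewrite yl dotZr => /eqP.
  by rewrite mulf_eq0 (gt_eqF aj) orbF => /eqP ->; rewrite scale0r.
exists w; split=> //; [|exact: optr|by rewrite /w !dotE ltrDl mulr_gt0].
split=> //; split=> //; split.
  move=> /(congr1 (fun z => z - u)); rewrite subrr /w addrAC subrr add0r.
  by move/esym/eqP; rewrite scaler_eq0 gt_eqF //= => /eqP.
split.
  by exists u, 0; rewrite lexx ler01 subr0 scale1r scale0r addr0.
exists (zeros u h); apply/seteqP; split=> y.
  move=> [s [/andP[s0 s1] ->]].
  have -> : (1 - s) *: u + s *: w = u + (s * t) *: h.
    by rewrite /w scalerDr scalerA addrA -scalerDl subrK scale1r.
  split.
    apply/in_polyP => i; have /in_polyP/(_ i) := Pu; have /in_polyP/(_ i) := Pt.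
    by rewrite !dotE; nra.
  move=> i; rewrite inE in_tight_set => /andP[/eqP e /eqP].
  by rewrite dot_row /a !dotE e => ->; rewrite mulr0 addr0.
move=> [Py yz]; have [|l yl] := ext (y - u).
  move=> i iz; rewrite /a !dotE -[dot _ y]dot_row yz //.
  by move: iz; rewrite inE in_tight_set => /andP[/eqP -> _]; rewrite subrr.
have {}yl : y = u + l *: h by rewrite -yl addrC subrK.
(* For [l < 0] every row tight at [u] would be both nonpositive and nonnegative on [h], forcing
   [h = 0]. *)
have l0 : 0 <= l.
  rewrite leNgt; apply/negP => ln; apply: hn0; apply: ku => i iu.
  apply: le_anti; rewrite th //=.
  have /in_polyP/(_ i) := Py; move: iu; rewrite in_tight_set => /eqP <-.
  by rewrite yl !dotE gerDl nmulr_rle0.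
have lt : l <= t.
  have /in_polyP/(_ j) := Py; move: jt; rewrite in_tight_set => /eqP <-.
  by rewrite yl !dotE lerD2l ler_pM2r.
exists (l / t); split.
  by rewrite divr_ge0 //= ler_pdivrMr // mul1r.
rewrite yl /w scalerDr scalerA divfK ?gt_eqF // addrA -scalerDl.
by rewrite subrK scale1r.
Qed.

Lemma adjacent_sym u w : adjacent A b u w -> adjacent A b w u.
Proof.
move=> [vu [vw [uw fs]]]; split=> //; split=> //; split; first exact/nesym.
suff -> : segment w u = segment u w by [].
apply/seteqP; split=> x [t [/andP[t0 t1] ->]]; exists (1 - t); split.
- by apply/andP; split; lra.
- by rewrite (_ : 1 - (1 - t) = t) 1?addrC //; ring.
- by apply/andP; split; lra.
- by rewrite (_ : 1 - (1 - t) = t) 1?addrC //; ring.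
Qed.

Lemma walk_cat k l u v w : walk A b k u v -> walk A b l v w -> walk A b (k + l) u w.
Proof. by elim=> // {}k {}u x {}v ux _ IH /IH; apply: walkS. Qed.

Lemma walk_sym k u v : walk A b k u v -> walk A b k v u.
Proof.
elim=> [x|{}k {}u x {}v ux _ IH]; first exact: walk0.
rewrite -addn1; apply: walk_cat IH _.
by apply: walkS (adjacent_sym ux) _; apply: walk0.
Qed.

(** The normal cones met by the segment from [p] to [q], each recorded by the tight set of its
    vertex. *)
Definition hits p q : {set {set 'I_m}} :=
  [set I | `[< exists v (t : R), [/\ is_vertex A b v, tight_set A b v = I,
    0 <= t <= 1 & opt A b (p + t *: (q - p)) v] >]].

Hypothesis rankA : \rank A = n.

(** The parametric simplex method: a vertex is kept up to the last objective for which it is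
    optimal, then left by a pivot that increases [q - p]. Hence the visited vertices are distinct,
    and the segment meets the cone of each. *)
Lemma segment_walk p q u : is_vertex A b u -> opt A b p u -> bounded A b q ->
  exists k w, [/\ is_vertex A b w, opt A b q w, walk A b k u w & (k <= #|hits p q|)%N].
Proof.
move=> vu ou bq; pose d := q - p.
(* The cones that can still be visited from [u]; this set shrinks at each pivot and bounds the rest
   of the walk. *)
pose above u := [set I in hits p q | dot d u < dot d (vert A b I)].
suff main k w t : (#|above w| < k)%N -> is_vertex A b w -> 0 <= t <= 1 ->
    opt A b (p + t *: d) w ->
    exists l v, [/\ is_vertex A b v, opt A b q v, walk A b l w v & (l <= #|above w|)%N].
  have [||l [v [vv oq wl la]]] := main _ u 0 (ltnSn _) vu.
  - by rewrite lexx ler01.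
  - by rewrite scale0r addr0.
  exists l, v; split=> //; apply: leq_trans la _; apply: subset_leq_card.
  by apply/fintype.subsetP => I; rewrite inE => /andP[].
have bp := opt_bounded ou.
have bseg s : 0 <= s <= 1 -> bounded A b (p + s *: d).
  move=> /andP[s0 s1].
  have -> : p + s *: d = (1 - s) *: p + s *: q.
    by rewrite /d scalerBr scalerBl scale1r addrA addrAC.
  by apply: boundedD; apply: boundedZ => //; lra.
elim: k w t => // k IH w t; rewrite ltnS => hk vw t01 ow.
have [oq|noq] := pselect (opt A b q w); first by exists 0%N, w; split=> //; apply: walk0.
have Pw : poly A b w := ow.1.
have [v vv ov] := opt_vertex rankA Pw bq.
have qvw : dot q w < dot q v.
  rewrite lt_neqAle ov.2 // andbT; apply/eqP => e; apply: noq.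
  exact: opt_of_eq ov Pw e.
have qE : q = p + d by rewrite /d addrC subrK.
have tvw := ow.2 v ov.1.
have dvw : 0 < dot d (v - w).
  move: t01 qvw tvw; rewrite qE !dotE => /andP[t0 t1]; nra.
(* Ratio test over all vertices: [s] is the largest increment for which [w] stays optimal at
   [t + s], and the vertex of [I] is optimal there too. *)
have [||s s0 [sP [I [/asboolP vI aI sI]]]] := @ratio_test R _
  [pred I | `[< is_vertex A b (vert A b I) >]]
  (fun I => dot d (vert A b I - w))
  (fun I => dot (p + t *: d) (w - vert A b I)).
- move=> I /asboolP/vertexP[PI _]; have := ow.2 _ PI.
  by rewrite !(dotDr _ _ (- _)) !dotNr subr_ge0.
- by exists (tight_set A b v); rewrite ?inE /= vertK //; apply/asboolP.
have sv : s * dot d (v - w) <= dot (p + t *: d) (w - v).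
  rewrite -[v](vertK vv); apply: sP; rewrite inE; apply/asboolP.
  by rewrite vertK.
have st1 : t + s < 1.
  rewrite ltNge; apply/negP => ts.
  by move: qvw sv dvw; rewrite qE !dotE; nra.
have st01 : 0 <= t + s <= 1 by move: t01 => /andP[t0 t1]; apply/andP; split; lra.
have ows : opt A b (p + (t + s) *: d) w.
  apply: opt_vertices => //; first exact: bseg.
  move=> x vx; rewrite -[x](vertK vx).
  have := sP (tight_set A b x); rewrite /= vertK // => /(_ (asboolT vx)).
  by rewrite !dotE; lra.
have oIs : opt A b (p + (t + s) *: d) (vert A b I).
  apply: opt_of_eq ows _ _; first by case/vertexP: vI.
  by move: sI; rewrite !dotE; lra.
have [||x [wx vx ox dx]] := pivot (d := d) vw ows oIs.
- by move: aI; rewrite !dotE subr_gt0.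
- have [K hK] := bq.
  (* On this optimal face the objective at [t + s] is constant, so the bound [K] on [q] bounds the
     remainder [(1 - (t + s)) * d]. *)
  exists ((K - dot (p + (t + s) *: d) w) / (1 - (t + s))) => y oy.
  rewrite ler_pdivlMr ?subr_gt0 //; have := hK y oy.1.
  by rewrite (dot_opt ows oy) qE !dotE; lra.
have sub : above x \proper above w.
  apply/fintype.properP; split.
    apply/fintype.subsetP => J; rewrite !inE => /andP[-> /=].
    exact: lt_trans.
  exists (tight_set A b x); last by rewrite inE vertK // ltxx andbF.
  rewrite inE vertK // dx andbT inE; apply/asboolP.
  by exists x, (t + s); split.
have [|l [y [vy oy wl la]]] := IH x (t + s) _ vx st01 ox.
  exact: leq_trans (proper_card sub) hk.
exists l.+1, y; split=> //; first exact: walkS wx wl.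
exact: leq_ltn_trans la (proper_card sub).
Qed.

End Walks.

(** * Bases and triangulations of the normal fan *)

(** Each expression is a nonzero polynomial in [s], so the product of all of them has finitely many
    roots. *)
Lemma moment_curve_avoids (R : realFieldType) (k : nat) (I : finType) (P : pred I)
    (g : I -> R) (a : I -> 'I_k -> R) (eta : R) : 0 < eta ->
  (forall i, P i -> exists j, a i j != 0) ->
  exists s, [/\ 0 < s, s < eta &
    forall i, P i -> g i + \sum_j a i j * s ^+ j.+1 != 0].
Proof.
move=> eta0 aP.
pose p i : {poly R} := (g i)%:P + \sum_j a i j *: 'X^(j.+1).
have pE i s : (p i).[s] = g i + \sum_j a i j * s ^+ j.+1.
  rewrite /p hornerD hornerC horner_sum; congr (_ + _).
  by apply: eq_bigr => j _; rewrite hornerZ hornerXn.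
have p0 i : P i -> p i != 0.
  move=> /aP[j0 aj0]; apply: contraNneq aj0 => /(congr1 (fun q : {poly R} => q`_j0.+1)).
  rewrite coef0 coefD coefC /= add0r coef_sum (bigD1 j0) //= coefZ coefXn eqxx mulr1.
  rewrite big1 ?addr0 => [->//|j jj0]; rewrite coefZ coefXn eqSS.
  by rewrite [val j0 == _]eq_sym (inj_eq val_inj) (negPf jj0) mulr0.
pose Q := \prod_(i | P i) p i.
have Q0 : Q != 0 by apply/prodf_neq0 => i /p0.
(* These are [size Q] distinct points of the interval from 0 to [eta], more than [Q] has roots. *)
pose rs := [seq eta / l.+2%:R | l <- iota 0 (size Q)].
have urs : uniq rs.
  rewrite map_inj_uniq ?iota_uniq // => x y /(mulfI (lt0r_neq0 eta0))/invr_inj/eqP.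
  by rewrite eqr_nat => /eqP[].
have [/(max_poly_roots Q0)/(_ urs)|] := boolP (all (root Q) rs).
  by rewrite size_map size_iota ltnn.
case/allPn => s /mapP[l _ ->] nroot; exists (eta / l.+2%:R); split.
- by rewrite divr_gt0 ?ltr0n.
- by rewrite ltr_pdivrMr ?ltr0n // ltr_pMr // ltr1n.
move=> i Pi; rewrite -pE; apply: contra nroot => /eqP pi0.
by rewrite /root /Q horner_prod (bigD1 i) //= pi0 mul0r.
Qed.

Lemma col_mulmx (R : realType) (m n p : nat) (M : 'M[R]_(m, n)) (N : 'M[R]_(n, p)) j :
  col j (M *m N) = M *m col j N.
Proof. by rewrite !colE mulmxA. Qed.

Section Bases.
Variables (R : realType) (m n : nat) (A : 'M[R]_(m, n)).
Implicit Types (f : {ffun 'I_n -> 'I_m}) (b : 'cV[R]_m) (r : 'rV[R]_n).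

Definition is_basis f := \det (rowsub f A) != 0.

Definition coord f r : 'rV[R]_n := r *m invmx (rowsub f A).

Definition solution f b : 'cV[R]_n := invmx (rowsub f A) *m rowsub f b.

Lemma basis_unit f : is_basis f -> rowsub f A \in unitmx.
Proof. by rewrite unitmxE unitfE. Qed.

Lemma mul_rowsub f (z : 'rV[R]_n) :
  z *m rowsub f A = \sum_j z 0 j *: row (f j) A.
Proof. by rewrite mulmx_sum_row; apply: eq_bigr => j _; rewrite row_rowsub. Qed.

Lemma coordK f r : is_basis f -> coord f r *m rowsub f A = r.
Proof. by move=> /basis_unit uf; rewrite /coord mulmxKV. Qed.

Lemma mul_rowsubK f (z : 'rV[R]_n) : is_basis f -> coord f (z *m rowsub f A) = z.
Proof. by move=> /basis_unit uf; rewrite /coord mulmxK. Qed.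

Lemma coord_sum f r : is_basis f -> r = \sum_j coord f r 0 j *: row (f j) A.
Proof. by move=> uf; rewrite -mul_rowsub coordK. Qed.

Lemma dot_solution f b r : dot r (solution f b) = \sum_l coord f r 0 l * b (f l) 0.
Proof.
rewrite /dot /solution mulmxA -/(coord f r) mxE.
by apply: eq_bigr => l _; congr (_ * _); rewrite mxE.
Qed.

Lemma row_solution f b j : is_basis f -> dot (row (f j) A) (solution f b) = b (f j) 0.
Proof.
move=> /basis_unit uf; rewrite -dot_row.
have -> : (A *m solution f b) (f j) 0 = (rowsub f (A *m solution f b)) j 0.
  by rewrite [RHS]mxE.
by rewrite -mul_rowsub_mx /solution mulKVmx // mxE.
Qed.

Lemma basis_ker f y : is_basis f -> (forall j, dot (row (f j) A) y = 0) -> y = 0.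
Proof.
move=> uf fy; apply: (@ker_full _ _ _ (rowsub f A)).
  by apply/eqP; rewrite mxrank_unit ?basis_unit.
apply/matrixP => i j; rewrite ord1 dot_row row_rowsub fy mxE //.
Qed.

Lemma rcone_coord f r : is_basis f -> (forall j, 0 <= coord f r 0 j) ->
  rcone A (f @: setT) r.
Proof.
move=> uf c0; exists (fun i => \sum_(j | f j == i) coord f r 0 j); split.
  by move=> i; apply: sumr_ge0.
split.
  move=> i iB; apply: big1 => j /eqP fj; case/negP: iB.
  by rewrite -fj imset_f ?inE.
rewrite [LHS](coord_sum r uf) (partition_big f predT) //=; apply: eq_bigr => i _.
by rewrite scaler_suml; apply: eq_bigr => j /eqP ->.
Qed.

Lemma rcone_opt b v (S : {set 'I_m}) r : poly A b v -> S \subset tight_set A b v ->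
  rcone A S r -> opt A b r v.
Proof.
move=> Pv /fintype.subsetP Sv [l [l0 [lS ->]]]; apply: opt_sum => // i.
have [iS|/lS ->] := boolP (i \in S); first by apply/optZ/opt_row/Sv.
by rewrite scale0r; split=> // x _; rewrite !dot0l.
Qed.

Lemma rcone_bounded b (S : {set 'I_m}) r : rcone A S r -> bounded A b r.
Proof.
move=> [l [l0 [_ ->]]]; exists (\sum_i l i * b i 0) => x /in_polyP Px.
by rewrite dot_suml ler_sum // => i _; rewrite dotZl ler_wpM2l.
Qed.

(** Zeroing the rows that are not tight leaves full rank, and a choice of [n] independent rows
    cannot use a zeroed one. *)
Lemma vertex_basis b v : is_vertex A b v ->
  exists2 f, is_basis f & forall j, f j \in tight_set A b v.
Proof.
move=> /vertexP[_ kv]; pose M := \matrix_(i, j) (if i \in tight_set A b v then A i j else 0).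
have rowM i : row i M = if i \in tight_set A b v then row i A else 0.
  by apply/rowP => j; rewrite !mxE; case: ifP => _; rewrite mxE.
have fM : row_full M.
  rewrite -cokermx_eq0; apply/eqP/matrixP => i j.
  have /colP/(_ i) : col j (cokermx M) = 0.
    apply: kv => k kt; have := congr1 (col j) (mulmx_coker M).
    rewrite col_mulmx => /colP/(_ k); rewrite dot_row rowM kt => ->.
    by rewrite !mxE.
  by rewrite !mxE.
pose f : {ffun 'I_n -> 'I_m} := fullrankfun fM.
have uf : rowsub f M \in unitmx := fullrowsub_unit fM.
have ft j : f j \in tight_set A b v.
  apply: contraLR uf => nt; rewrite unitmxE unitfE negbK (expand_det_row _ j).
  rewrite big1 // => k _; rewrite !mxE (negPf nt) mul0r //.
exists f => //; rewrite /is_basis -unitfE -unitmxE.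
suff -> : rowsub f A = rowsub f M by [].
by apply/matrixP => i j; rewrite !mxE ft.
Qed.

Lemma solution_vertex f b : is_basis f -> poly A b (solution f b) ->
  is_vertex A b (solution f b) /\ f @: setT \subset tight_set A b (solution f b).
Proof.
move=> uf Pf.
have ft j : f j \in tight_set A b (solution f b).
  by rewrite in_tight_set row_solution.
split; last by apply/fintype.subsetP => i /imsetP[j _ ->].
apply/vertexP; split=> // y yt; apply: (basis_ker uf) => j.
exact: yt.
Qed.

Lemma solution_unique f b v : is_basis f -> (forall j, f j \in tight_set A b v) ->
  v = solution f b.
Proof.
move=> uf fv; apply/eqP; rewrite -subr_eq0; apply/eqP/(basis_ker uf) => j.
rewrite !dotE row_solution //; move: (fv j); rewrite in_tight_set => /eqP ->.
by rewrite subrr.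
Qed.

Lemma absdet_ge f : `|\det (rowsub f A)| <= absdet A (f @: setT).
Proof. by rewrite /absdet; apply: (le_bigmax_cond 0 (fun g : {ffun _} => `|\det (rowsub g A)|)). Qed.

(** Nondegeneracy, demanded at every basic solution, feasible or not. *)
Definition simple b := forall f j, is_basis f -> (forall l, f l != j) ->
  dot (row j A) (solution f b) != b j 0.

Lemma simple_tight f b : simple b -> is_basis f ->
  tight_set A b (solution f b) = f @: setT.
Proof.
move=> sb uf; apply/setP => i; apply/idP/imsetP => [it|[j _ ->]]; last first.
  by rewrite in_tight_set row_solution.
apply: contrapT => ni; move: it; rewrite in_tight_set; apply/negP/sb => // l.
by apply/eqP => fl; apply: ni; exists l; rewrite ?inE.
Qed.

Lemma simple_opt f b r : simple b -> is_basis f ->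
  opt A b r (solution f b) -> forall j, 0 <= coord f r 0 j.
Proof.
(* [g] lowers row [f j] by 1 and fixes the other basis rows. By simplicity no further row is tight,
   so [g] is feasible, and [r] takes minus its [j]-th coordinate on it. *)
move=> sb uf of_ j; pose g := - col j (invmx (rowsub f A)).
have fg l : dot (row (f l) A) g = - (l == j)%:R.
  rewrite dotNr -row_rowsub -dot_row -col_mulmx mulmxV ?basis_unit //.
  by rewrite !mxE.
have : dot r g <= 0.
  apply: opt_direction of_ _ => i; rewrite simple_tight // => /imsetP[l _ ->].
  by rewrite fg oppr_le0 ler0n.
by rewrite dotNr oppr_le0 /dot -col_mulmx mxE.
Qed.

(** Adding [s ^+ i.+1] to [b i 0] destroys all coincidences for generic [s], and for small [s] a
    basis that is infeasible for [b] stays infeasible. *)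
Lemma simple_perturbation b : exists b', [/\ simple b', forall i, b i 0 <= b' i 0 &
  forall f, is_basis f -> poly A b' (solution f b') -> poly A b (solution f b)].
Proof.
pose mu (t : {ffun 'I_n -> 'I_m} * 'I_m) l : R := coord t.1 (row t.2 A) 0 l.
(* The violation of inequality [t.2] at the basic solution of [t.1]. *)
pose gap t := \sum_l mu t l * b (t.1 l) 0 - b t.2 0.
have [t|t t0 tP] := @small_step R _ [pred t | is_basis t.1 && (0 < gap t)]
  (fun t => 1 + \sum_l `|mu t l|) gap; first by move=> /andP[].
have eta0 : 0 < Num.min t 1 by rewrite lt_min t0 ltr01.
(* The coefficient of [s ^+ i.+1] in the slack of inequality [t.2] at the perturbed basic solution;
   for [i = t.2] outside the basis it is 1. *)
pose al (t : {ffun 'I_n -> 'I_m} * 'I_m) (i : 'I_m) : R :=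
  (i == t.2)%:R - \sum_(l | t.1 l == i) mu t l.
have [|s [s0 + sP]] := @moment_curve_avoids R m _
  [pred t : {ffun 'I_n -> 'I_m} * 'I_m | is_basis t.1 && [forall l, t.1 l != t.2]]
  (fun t => - gap t) al _ eta0.
  move=> [f j] /andP[/= _ /forallP fj]; exists j; rewrite /al eqxx /= big1.
    by rewrite subr0 oner_neq0.
  by move=> l /eqP e; have := fj l; rewrite e eqxx.
rewrite lt_min => /andP[st s1].
pose b' : 'cV[R]_m := \col_i (b i 0 + s ^+ i.+1).
have b'i i : b' i 0 = b i 0 + s ^+ i.+1 by rewrite mxE.
have b'E f j : dot (row j A) (solution f b') - b' j 0 =
    gap (f, j) + (\sum_l mu (f, j) l * s ^+ (f l).+1 - s ^+ j.+1).
  rewrite dot_solution b'i /gap /=.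
  under eq_bigr do rewrite b'i mulrDr.
  by rewrite big_split /= /mu /=; ring.
exists b'; split.
- move=> f j uf fj; rewrite -subr_eq0 b'E.
  have alE : \sum_i al (f, j) i * s ^+ i.+1 =
      s ^+ j.+1 - \sum_l mu (f, j) l * s ^+ (f l).+1.
    rewrite /al; under eq_bigr do rewrite mulrBl.
    rewrite sumrB (bigD1 j) //= eqxx mul1r big1 ?addr0; last first.
      by move=> i /negPf ->; rewrite mul0r.
    congr (_ - _); rewrite [RHS](partition_big f predT) //=.
    by apply: eq_bigr => i _; rewrite mulr_suml; apply: eq_bigr => l /eqP ->.
  have : - gap (f, j) + \sum_i al (f, j) i * s ^+ i.+1 != 0.
    by apply: sP; rewrite /= uf; apply/forallP.
  by rewrite alE; apply: contra => /eqP e; apply/eqP; lra.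
- by move=> i; rewrite b'i lerDl exprn_ge0 // ltW.
move=> f uf Pf; apply/in_polyP => j; rewrite leNgt; apply/negP => bj.
have gj : 0 < gap (f, j) by rewrite /gap -dot_solution subr_gt0.
have := tP (f, j); rewrite /= uf gj => /(_ isT) tg.
have /in_polyP/(_ j) := Pf; rewrite -subr_le0 b'E leNgt => /negP; apply.
have sk k : 0 <= s ^+ k.+1 <= s.
  rewrite exprn_ge0 ?(ltW s0) //= exprS ler_piMr ?(ltW s0) //.
  by apply: exprn_ile1; apply: ltW.
have : - (s * \sum_l `|mu (f, j) l|) <= \sum_l mu (f, j) l * s ^+ (f l).+1.
  rewrite mulr_sumr -sumrN; apply: ler_sum => l _.
  have /andP[h0 h1] := sk (f l); have := ler_norm (- mu (f, j) l).
  by have := normr_ge0 (mu (f, j) l); rewrite normrN; nra.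
have /andP[h0 h1] := sk j; move: tg.
have : 0 <= \sum_l `|mu (f, j) l| by apply: sumr_ge0.
nra.
Qed.

(** The feasible bases of the perturbed system form the triangulation: their cones are the normal
    cones of a simple polyhedron, hence a fan, and these bases are still feasible for [b]. *)
Lemma triangulation_exists b : \rank A = n ->
  exists T, triangulation A b T.
Proof.
move=> rankA; have [b' [sb bb' fb]] := simple_perturbation b.
pose feasible f := is_basis f /\ poly A b' (solution f b').
pose T := [set B | `[< exists2 f, feasible f & f @: setT = B >]].
have TP B : B \in T -> exists2 f, feasible f & f @: setT = B.
  by rewrite inE => /asboolP.
have inT f : feasible f -> f @: setT \in T.
  by move=> ff; rewrite inE; apply/asboolP; exists f.
have coneP f r : feasible f -> rcone A (f @: setT) r <-> opt A b' r (solution f b').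
  move=> [uf Pf]; split; last by move=> /(simple_opt sb uf); apply: rcone_coord.
  by apply: rcone_opt => //; rewrite simple_tight.
have faceP f f' : feasible f -> feasible f' -> cone_face (rcone A (f @: setT))
    (rcone A (f @: setT) `&` rcone A (f' @: setT))%classic.
  move=> ff ff'; exists (solution f' b' - solution f b').
  split=> [y /(coneP _ _ ff)[_ oy]|].
    by rewrite -/(dot _ _) !dotE subr_le0 oy //; case: ff'.
  apply/seteqP; split=> y [/= yf].
    move=> /(coneP _ _ ff') o'; split=> //.
    rewrite -/(dot _ _) !dotE; apply/eqP; rewrite subr_eq0; apply/eqP.
    by apply: dot_opt o' _; apply/coneP.
  rewrite -/(dot _ _) !dotE => /eqP; rewrite subr_eq0 => /eqP e.
  split=> //=; apply/(coneP _ _ ff'); move/(coneP _ _ ff): yf => oy.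
  by apply: opt_of_eq oy _ e; case: ff'.
exists T; split.
- move=> B /TP[f [uf Pf] <-]; split.
    rewrite gt_eqF //; apply: lt_le_trans (absdet_ge f).
    by rewrite normr_gt0.
  by exists (solution f b); apply: solution_vertex => //; apply: fb.
- move=> v vv; have [Pv kv] := (vertexP _ _ _).1 vv.
  have Pv' : poly A b' v.
    by apply/in_polyP => i; apply: le_trans (bb' i); move/in_polyP: Pv.
  apply/seteqP; split=> r; last first.
    move=> [B [_ /fintype.subsetP Bv] [l [l0 [lB rE]]]]; exists l; split=> //; split=> //.
    by move=> i iv; apply: lB; apply: contra iv; apply: Bv.
  move=> [l [l0 [lv rE]]].
  (* The sum of the tight rows is interior to the normal cone of [v]: over the original polyhedron
     only [v] maximizes it. *)
  pose y := \sum_(i < m) (i \in tight_set A b v)%:R *: row i A.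
  (* [e] is so small that negative coordinates of [r] stay negative for [r + e *: y]. *)
  have [[f j]|e e0 eP] := @small_step R _
    [pred t : {ffun 'I_n -> 'I_m} * 'I_n | coord t.1 r 0 t.2 < 0]
    (fun t => coord t.1 y 0 t.2) (fun t => - coord t.1 r 0 t.2).
    by rewrite /= oppr_gt0.
  have ry : rcone A (tight_set A b v) (r + e *: y).
    exists (fun i => l i + e * (i \in tight_set A b v)%:R); split.
      by move=> i; rewrite addr_ge0 // mulr_ge0 ?ler0n // ltW.
    split; first by move=> i iv; rewrite lv // (negPf iv) mulr0 addr0.
    rewrite rE scaler_sumr -big_split /=; apply: eq_bigr => i _.
    by rewrite scalerDl scalerA.
  have [x vx ox] := opt_vertex rankA Pv' (rcone_bounded b' ry).
  have [f uf fx] := vertex_basis vx.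
  have xE := solution_unique uf fx.
  have ff : feasible f by split=> //; rewrite -xE; case: ox.
  have c0 : forall j, 0 <= coord f (r + e *: y) 0 j.
    by apply: (simple_opt sb uf); rewrite -xE.
  have [vf tf] := solution_vertex uf (fb f uf ff.2).
  (* Since [v] maximizes both [r] and [y], the maximizer [solution f b] of [r + e *: y] also
     maximizes [y], so every row tight at [v] is tight there. *)
  have vE : v = solution f b.
    have of_ : opt A b (r + e *: y) (solution f b).
      by apply: rcone_opt tf (rcone_coord uf c0); case/vertexP: vf.
    have or_ : opt A b r v.
      by apply: (rcone_opt Pv (fintype.subxx _)); exists l.
    have oy : opt A b y v.
      apply: (rcone_opt Pv (fintype.subxx _)); exists (fun i => (i \in tight_set A b v)%:R).
      by split=> [i|]; [exact: ler0n|split=> // i /negPf ->].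
    have yE : dot y (solution f b) = dot y v.
      have := or_.2 _ of_.1; have := oy.2 _ of_.1; have := of_.2 _ Pv.
      rewrite !dotE => h1 h2 h3; apply: le_anti; rewrite h2 /=; nra.
    apply/esym/eqP; rewrite -subr_eq0; apply/eqP/kv => i iv.
    have : \sum_(i < m) (i \in tight_set A b v)%:R * (b i 0 - dot (row i A) (solution f b)) = 0.
      have : dot y v - dot y (solution f b) = 0 by rewrite yE subrr.
      rewrite !dot_suml -sumrB => y0; rewrite -[RHS]y0; apply: eq_bigr => k _; rewrite !dotZl.
      have [kt|_] := boolP (k \in _); last by rewrite !mul0r subrr.
      by move: kt; rewrite in_tight_set => /eqP <-; rewrite !mul1r.
    move=> /eqP; rewrite psumr_eq0; last first.
      by move=> k _; rewrite mulr_ge0 ?ler0n // subr_ge0; have /in_polyP := of_.1.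
    move=> /allP/(_ i (mem_index_enum _)); rewrite iv mul1r subr_eq0 => /eqP bi.
    rewrite !dotE -bi; move: iv; rewrite in_tight_set => /eqP ->; exact: subrr.
  exists (f @: setT); first by split; [exact: inT|rewrite vE].
  apply: rcone_coord => // j; rewrite leNgt; apply/negP => cj.
  have := eP (f, j) cj; have := c0 j.
  by rewrite /coord mulmxDl -scalemxAl !mxE /=; lra.
- move=> B B' /TP[f ff <-] /TP[f' ff' <-]; split; first exact: faceP.
  by rewrite setIC; apply: faceP.
Qed.

End Bases.

(** * Determinants and coordinates *)

Section Determinants.
Variables (R : realType) (m n : nat) (A : 'M[R]_(m, n)).
Implicit Types (f : {ffun 'I_n -> 'I_m}) (b : 'cV[R]_m).

Lemma basis_card f : is_basis A f -> #|f @: setT| == n.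
Proof.
move=> uf; rewrite card_imset; last move=> i j fij.
  by rewrite (@eq_card _ _ predT) ?card_ord // => i; apply/asboolP.
apply/eqP; apply: contraNT uf => ij; apply/eqP;
apply: (determinant_alternate ij) => k.
by rewrite !mxE fij.
Qed.

Lemma det_le_Delta f : `|\det (rowsub f A)| <= Delta A.
Proof.
have [->|uf] := eqVneq (\det (rowsub f A)) 0.
  by rewrite normr0 /Delta; elim/big_ind: _ => [|x y x0 y0|B _] //;
    [rewrite le_max x0|exact: bigmax_ge_id].
apply: le_trans (absdet_ge A f) _.
by apply: (le_bigmax_cond 0 (absdet A)); rewrite basis_card.
Qed.

(** Cramer's rule: the coordinate is a quotient of determinants, with row [f j] replaced by row [i]
    in the numerator. *)
Lemma coord_row_le f i j : is_basis A f ->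
  `|coord A f (row i A) 0 j| <= Delta A / `|\det (rowsub f A)|.
Proof.
move=> uf; have uf' := basis_unit uf.
pose g : {ffun 'I_n -> 'I_m} := [ffun l => if l == j then i else f l].
suff -> : coord A f (row i A) 0 j = \det (rowsub g A) / \det (rowsub f A).
  by rewrite normrM normfV ler_wpM2r ?invr_ge0 ?normr_ge0 // det_le_Delta.
rewrite /coord /invmx uf' -scalemxAr mxE mulrC; congr (_ / _).
rewrite (expand_det_row _ j) mxE; apply: eq_bigr => k _.
rewrite !mxE !ffunE eqxx; congr (_ * _); rewrite /cofactor; congr (_ * \det _).
by apply/matrixP => s t; rewrite !mxE ffunE eq_sym (negPf (neq_lift _ _)).
Qed.

(** Some triangulation attains the maximum in [Delta_min]; it has a cone at every vertex, and all
    its determinants are nonzero. *)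
Lemma vertex_large_basis b : \rank A = n -> pointed A b ->
  [/\ 0 < Delta_min A b, Delta_min A b <= Delta A,
    exists2 f, is_basis A f & `|\det (rowsub f A)| = Delta A &
    forall v, is_vertex A b v -> exists f, [/\ is_basis A f,
      forall j, f j \in tight_set A b v & Delta_min A b <= `|\det (rowsub f A)|]].
Proof.
move=> rankA [v0 vv0].
have absdet0 B : 0 <= absdet A B by apply: bigmax_ge_id.
have absdetP B : absdet A B != 0 ->
    exists2 f : {ffun _}, f @: setT = B & absdet A B = `|\det (rowsub f A)|.
  move=> nB; have [f0 /eqP f0B] : exists f : {ffun 'I_n -> 'I_m}, f @: setT == B.
    apply: contrapT => nf; case/eqP: nB; rewrite /absdet big_pred0 // => f.
    by apply/negP => fB; apply: nf; exists f.
  have [||f fB fE] := @eq_bigmax _ _ _ (0 : R) f0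
    [pred f : {ffun 'I_n -> 'I_m} | f @: setT == B] (fun f => `|\det (rowsub f A)|).
  - exact/eqP.
  - by move=> *; apply: normr_ge0.
  by exists f; [exact/eqP|exact: fE].
have [f0 uf0 _] := vertex_basis vv0.
have D0 : 0 < Delta A by apply: lt_le_trans (det_le_Delta f0); rewrite normr_gt0.
have tri0 T : triangulation A b T -> 0 < tri_min A T.
  move=> [TB _ _]; rewrite /tri_min; elim/big_ind: _ => //.
    by move=> x y x0 y0; rewrite lt_min x0.
  by move=> B /TB[nB _]; rewrite lt_neqAle eq_sym nB absdet0.
have [T0 tT0] := triangulation_exists b rankA.
have [||T /asboolP tT DE] := @eq_bigmax _ _ _ (0 : R) T0
    [pred T | `[< triangulation A b T >]] (tri_min A).
- exact/asboolP.
- by move=> T /asboolP/tri0/ltW.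
have {}DE : Delta_min A b = tri_min A T := DE.
rewrite {}DE; have Tp := tri0 _ tT; have [TB Tv _] := tT.
have Tle B : B \in T -> tri_min A T <= absdet A B.
  by move=> BT; apply: (bigmin_le_cond (Delta A) (absdet A)).
have vf v : is_vertex A b v -> exists f, [/\ is_basis A f,
      forall j, f j \in tight_set A b v & tri_min A T <= `|\det (rowsub f A)|].
  (* The covering property is applied to the zero vector, merely to obtain a member of [T] tight at
     [v]. *)
  move=> vv; have := Tv v vv => /seteqP[+ _] => /(_ 0)[|B [BT /fintype.subsetP Bv] _].
    exists (fun=> 0); split=> //; split=> //.
    by rewrite big1 // => i _; rewrite scale0r.
  have [nB _] := TB B BT; have [f fB fE] := absdetP _ nB.
  exists f; split; first by rewrite /is_basis -normr_eq0 -fE.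
    by move=> j; apply: Bv; rewrite -fB imset_f ?inE.
  by rewrite -fE Tle.
split=> //.
  have [f [_ _ /le_trans]] := vf _ vv0; apply; exact: det_le_Delta.
have [||B _ DE] := @eq_bigmax _ _ _ (0 : R) (f0 @: setT)
    [pred B : {set 'I_m} | #|B| == n] (absdet A).
- exact: basis_card.
- by move=> B _; apply: absdet0.
have {}DE : Delta A = absdet A B := DE.
have [|f fB fE] := absdetP B.
  by rewrite -DE gt_eqF.
exists f; last by rewrite -fE -DE.
by rewrite /is_basis -normr_eq0 -fE -DE gt_eqF.
Qed.

End Determinants.

(** * The gauge of the convex hull of the origin and the rows *)

Section Gauge.
Variables (R : realType) (m n : nat) (A : 'M[R]_(m, n)).
Implicit Types (f : {ffun 'I_n -> 'I_m}) (b : 'cV[R]_m) (x y : 'rV[R]_n).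

(** For [rho >= 0], the dilate by [rho] of the convex hull of the origin and the rows. It lies in
    the cone of the rows, so its members are bounded objectives. *)
Definition gauge_le (rho : R) x := exists l : 'I_m -> R,
  [/\ forall i, 0 <= l i, \sum_i l i <= rho & x = \sum_i l i *: row i A].

Lemma gauge_leD rho sigma x y : gauge_le rho x -> gauge_le sigma y ->
  gauge_le (rho + sigma) (x + y).
Proof.
move=> [l [l0 ls ->]] [k [k0 ks ->]]; exists (fun i => l i + k i); split.
- by move=> i; rewrite addr_ge0.
- by rewrite big_split lerD.
- by rewrite -big_split; apply: eq_bigr => i _; rewrite scalerDl.
Qed.

Lemma gauge_leW rho sigma x : rho <= sigma -> gauge_le rho x -> gauge_le sigma x.
Proof. by move=> rs [l [l0 ls ->]]; exists l; split=> //; apply: le_trans rs. Qed.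

Lemma gauge_le0 : gauge_le 0 0.
Proof.
exists (fun=> 0); split=> //; first by rewrite big1.
by rewrite big1 // => i _; rewrite scale0r.
Qed.

Lemma gauge_bounded b rho x : gauge_le rho x -> bounded A b x.
Proof.
by move=> [l [l0 _ xE]]; apply: (@rcone_bounded _ _ _ _ _ [set i | true]); exists l; split=> //;
  split=> // i; rewrite inE.
Qed.

Lemma gauge_coord f k rho x j : 0 <= k ->
  (forall i j, `|coord A f (row i A) 0 j| <= k) ->
  gauge_le rho x -> `|coord A f x 0 j| <= k * rho.
Proof.
move=> k0 fk [l [l0 ls ->]]; rewrite /coord mulmx_suml summxE.
apply: le_trans (ler_norm_sum _ _ _) _; apply: le_trans (ler_wpM2l k0 ls).
rewrite mulr_sumr; apply: ler_sum => i _.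
rewrite -scalemxAl mxE normrM ger0_norm // mulrC ler_wpM2r //.
exact: fk.
Qed.

Lemma gauge_basis f rho (z : 'rV[R]_n) : (forall j, 0 <= z 0 j) ->
  \sum_j z 0 j <= rho -> gauge_le rho (z *m rowsub f A).
Proof.
move=> z0 zs; exists (fun i => \sum_(j | f j == i) z 0 j); split.
- by move=> i; apply: sumr_ge0.
- by apply: le_trans zs; rewrite [leRHS](partition_big f predT).
rewrite mul_rowsub (partition_big f predT) //=; apply: eq_bigr => i _.
by rewrite scaler_suml; apply: eq_bigr => j /eqP ->.
Qed.

Lemma basis_opt b f v x : is_basis A f -> poly A b v ->
  (forall j, f j \in tight_set A b v) ->
  (forall j, 0 <= coord A f x 0 j) -> opt A b x v.
Proof.
move=> uf Pv fv x0; rewrite (coord_sum x uf); apply: opt_sum => // j.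
exact/optZ/opt_row.
Qed.

End Gauge.

(** * Counting lattice points *)

Lemma sum_card_exchange (I K : finType) (S : {set K}) (H : K -> {set I}) :
  (\sum_(k in S) #|H k| = \sum_i #|[set k in S | i \in H k]|)%N.
Proof.
under eq_bigr do rewrite -sum1_card.
rewrite (exchange_big_dep predT) //=; apply: eq_bigr => i _.
by rewrite -sum1_card; apply: eq_bigl => k; rewrite inE.
Qed.

Lemma exists_le_average (K : finType) (S : {set K}) (h : K -> nat) (T : nat) :
  (0 < #|S|)%N -> (\sum_(k in S) h k <= T * #|S|)%N ->
  exists2 k, k \in S & (h k <= T)%N.
Proof.
move=> S0 hT; apply: contrapT => nk.
have : (\sum_(k in S) T.+1 <= \sum_(k in S) h k)%N.
  apply: leq_sum => k kS; rewrite ltnNge; apply/negP => kT.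
  by apply: nk; exists k.
rewrite sum_nat_const => /leq_trans/(_ hT).
by rewrite mulnC leq_pmul2r // ltnn.
Qed.

Lemma pow_half_le2 (R : realFieldType) (n : nat) : (0 < n)%N ->
  (1 + (2 * n%:R)^-1 : R) ^+ n <= 2.
Proof.
move=> n0; set a := (2 * n%:R)^-1; have np : 0 < (n%:R : R) by rewrite ltr0n.
have an : 2 * n%:R * a = 1 by rewrite mulfV // gt_eqF // mulr_gt0.
have a0 : 0 < a by rewrite invr_gt0 mulr_gt0.
clearbody a.
(* A reversed Bernoulli inequality with doubled slope, valid while [2 * j * a <= 1]. *)
suff H j : (j <= n)%N -> (1 + a) ^+ j <= 1 + 2 * j%:R * a.
  by apply: le_trans (H n (leqnn n)) _; rewrite an; lra.
elim: j => [|j IH] jn; first by rewrite expr0 !mulr0 mul0r addr0.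
have := IH (ltnW jn); have : (j%:R : R) <= n%:R by rewrite ler_nat ltnW.
rewrite exprSr -[j.+1%:R]natr1; have : 0 <= (j%:R : R) by rewrite ler0n.
move: ((1 + a) ^+ j) => p; move: (j%:R) an => t.
move: (n%:R : R) np => N np an t0 tN pt.
have : 2 * t * a <= 2 * N * a by rewrite ler_pM2r // ler_pM2l.
rewrite an => ta.
nra.
Qed.

Lemma pow_ge1Dx (R : realFieldType) (a : R) (j : nat) : 0 <= a ->
  1 + j%:R * a <= (1 + a) ^+ j.
Proof.
move=> a0; elim: j => [|j IH]; first by rewrite mul0r addr0.
rewrite exprSr -[j.+1%:R]natr1; have : 0 <= (j%:R : R) by rewrite ler0n.
by move: ((1 + a) ^+ j) IH => p IH; nra.
Qed.

Section Lattice.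
Variables (R : realType) (m n : nat) (A : 'M[R]_(m, n)).
Variables (f0 : {ffun 'I_n -> 'I_m}).
Hypotheses (n_gt0 : (0 < n)%N) (basis0 : is_basis A f0).
Hypothesis coord0 : forall i j, `|coord A f0 (row i A) 0 j| <= 1.

(** Integer combinations of the rows of [f0] with coefficients from [- L] to [L], indexed by a
    finite type through the shift by [L]. *)
Definition lattice_pt L (k : {ffun 'I_n -> 'I_(L.*2.+1)}) : 'rV[R]_n :=
  (\row_j ((k j)%:R - L%:R)) *m rowsub f0 A.

Definition lattice_ball (rho : R) L : {set {ffun 'I_n -> 'I_(L.*2.+1)}} :=
  [set k | `[< gauge_le A rho (lattice_pt k) >]].

Lemma lattice_pt_inj L : injective (@lattice_pt L).
Proof.
move=> k k' /(congr1 (coord A f0)); rewrite !mul_rowsubK // => /rowP e.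
apply/ffunP => j; apply: val_inj; have /eqP := e j; rewrite !mxE.
by rewrite (inj_eq (addIr _)) eqr_nat => /eqP.
Qed.

(** By [coord0], a vector of gauge at most [L] has [f0]-coordinates in [[- L, L]], so the translate
    does not leave the finite box. *)
Lemma lattice_pt_shift L (k : {ffun 'I_n -> 'I_(L.*2.+1)}) (e : 'I_n -> int) rho :
  rho <= L%:R -> gauge_le A rho (lattice_pt k + (\row_j (e j)%:~R) *m rowsub f0 A) ->
  exists k' : {ffun 'I_n -> 'I_(L.*2.+1)},
    lattice_pt k' = lattice_pt k + (\row_j (e j)%:~R) *m rowsub f0 A.
Proof.
rewrite /lattice_pt -mulmxDl => rL gk.
have bnd j : `|(k j)%:R - L%:R + (e j)%:~R : R| <= L%:R.
  have := gauge_coord j ler01 coord0 gk; rewrite mul_rowsubK // !mxE mul1r.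
  by move=> h; apply: le_trans h rL.
have kz j : (0 <= (k j)%:Z + e j <= (L.*2)%:Z).
  have := bnd j; rewrite ler_norml => /andP[h1 h2].
  have L2 : (L.*2%:R : R) = 2 * L%:R by rewrite -mul2n natrM.
  by apply/andP; split; rewrite -(ler_int R) intrD -!pmulrn ?L2; lra.
exists [ffun j => inord (absz ((k j)%:Z + e j))]; congr (_ *m _); apply/rowP => j.
have /andP[k0 k1] := kz j.
rewrite !mxE ffunE inordK; last first.
  by rewrite ltnS -lez_nat gez0_abs.
rewrite addrAC; congr (_ - _).
by rewrite pmulrn gez0_abs // intrD.
Qed.

Lemma lattice_ball_gt0 rho L : 0 <= rho -> (0 < #|lattice_ball rho L|)%N.
Proof.
move=> rho0; apply/card_gt0P; exists [ffun=> inord L]; rewrite inE; apply/asboolP.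
apply: gauge_leW rho0 _; rewrite /lattice_pt (_ : \row_j _ = 0).
  by rewrite mul0mx; apply: gauge_le0.
apply/rowP => j; rewrite !mxE ffunE inordK ?subrr //.
by rewrite ltnS -addnn leq_addr.
Qed.

(* If every dilation by q = 1 + 1/(2n) more than tripled the count, then, since
   q^n <= 2, doubling the radius would multiply the count by more than 3^n,
   against at most (2L+1)^n points in a box of half-width L. *)
Lemma lattice_ball_growth rho0 : 1 <= rho0 -> exists rho L,
  [/\ rho0 <= rho, rho * (1 + (2 * n%:R)^-1) <= L%:R &
    (#|lattice_ball (rho * (1 + (2 * n%:R)^-1)) L| <= 3 * #|lattice_ball rho L|)%N].
Proof.
move=> rho0_ge1; set q := 1 + _; apply: contrapT => H.
have q2 : q ^+ n <= 2 by apply: pow_half_le2.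
have q1 : 1 <= q by rewrite lerDl invr_ge0 mulr_ge0 ?ler0n.
have q0 : 0 <= q := le_trans ler01 q1.
(* [J] counts doublings of the radius. It makes [1 + J / 2], a lower bound for [(3 / 2) ^ J], exceed
   [2 * rho0 + 3], which bounds [(2 * L + 1) / 2 ^ J]. *)
pose J := (Num.truncn (4 * rho0 + 4)).+1.
have J_gt : 4 * rho0 + 4 < J%:R.
  by have /andP[] := @truncn_itv _ (4 * rho0 + 4) ltac:(lra).
pose x := rho0 * 2 ^+ J; have p1 : 1 <= (2 : R) ^+ J by apply: exprn_ege1; lra.
have x0 : 0 <= x by rewrite /x; nra.
have /andP[Lx xL] := truncn_itv x0; set L := (Num.truncn x).+1 in xL.
pose rho j := rho0 * q ^+ j.
have rhoL j : (j <= n * J)%N -> rho j <= L%:R.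
  move=> jn; apply: le_trans (ltW xL); rewrite ler_wpM2l //; first by lra.
  apply: le_trans (ler_weXn2l q1 jn) _; rewrite exprM.
  by apply: lerXn2r q2; rewrite nnegrE ?exprn_ge0.
have grow j : (j <= n * J)%N -> (3 ^ j <= #|lattice_ball (rho j) L|)%N.
  elim: j => [|j IH] jn; first by rewrite expn0 lattice_ball_gt0 // /rho expr0; lra.
  rewrite leqNgt; apply/negP => lt3; apply: H; exists (rho j), L; split.
  - by rewrite /rho ler_peMr ?exprn_ege1 //; lra.
  - by have := rhoL _ jn; rewrite /rho exprSr mulrA.
  rewrite -mulrA -exprSr -/(rho j.+1); apply: leq_trans (ltnW lt3) _.
  by rewrite expnS leq_pmul2l // IH // ltnW.
have := grow _ (leqnn _); rewrite mulnC expnM => /leq_trans/(_ (max_card _)).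
rewrite card_ffun !card_ord leq_exp2r // -(ler_nat R) natrX => h3.
have hL : (L.*2.+1%:R : R) <= (2 * rho0 + 3) * 2 ^+ J.
  rewrite -natr1 -muln2 natrM -[L%:R]natr1; move: Lx; rewrite /x; nra.
have h32 : (1 + J%:R * (1 / 2) : R) * 2 ^+ J <= ((1 + 1 / 2) * 2) ^+ J.
  by rewrite exprMn ler_wpM2r ?exprn_ge0 //; apply: pow_ge1Dx; lra.
have e3 : (1 + 1 / 2) * 2 = 3%:R :> R by lra.
have := h32; rewrite e3 => /le_trans/(_ (le_trans h3 hL)); rewrite ler_pM2r; last by lra.
lra.
Qed.

(* Rounding 3/2 theta times the sum of the rows of f to the lattice. *)
Lemma lattice_direction f k theta : is_basis A f -> 0 <= k ->
  (forall i j, `|coord A f (row i A) 0 j| <= k) -> n%:R * k <= theta / 2 ->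
  exists (e : 'I_n -> int) (z : 'rV[R]_n),
    (\row_j (e j)%:~R) *m rowsub f0 A = z *m rowsub f A /\
    forall j, theta <= z 0 j <= 2 * theta.
Proof.
move=> uf k0 fk nk.
pose y := coord A f0 ((const_mx (3 / 2 * theta)) *m rowsub f A).
pose e j := Num.floor (y 0 j); pose d : 'rV[R]_n := \row_j (y 0 j - (e j)%:~R).
exists e, (const_mx (3 / 2 * theta) - coord A f (d *m rowsub f0 A)); split.
  rewrite mulmxBl coordK // (_ : \row_j _ = y - d).
    by rewrite mulmxBl coordK.
  by apply/rowP => j; rewrite !mxE; ring.
move=> j.
(* The rounding error has gauge at most [n], so it changes the coordinates [3 / 2 * theta] by at
   most [n * k <= theta / 2]. *)
have : `|coord A f (d *m rowsub f0 A) 0 j| <= k * n%:R.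
  apply: gauge_coord => //; apply: gauge_basis => [l|].
    by rewrite mxE subr_ge0 floor_le.
  rewrite -[n in leRHS]card_ord -sumr_const; apply: ler_sum => l _.
  by rewrite mxE lerBlDl -[1]/(1%:~R) -intrD ltW // floorD1_gt.
move: (coord A f (d *m _)) => w; rewrite !mxE ler_norml => /andP[h1 h2].
by apply/andP; split; lra.
Qed.

End Lattice.

(** * Short walks *)

Section ShortWalk.
Variables (R : realType) (m n : nat) (A : 'M[R]_(m, n)) (b : 'cV[R]_m).
Hypotheses (n_gt0 : (0 < n)%N) (rankA : \rank A = n).
Variables (kappa : R) (f0 : {ffun 'I_n -> 'I_m}) (F : 'cV[R]_n -> {ffun 'I_n -> 'I_m}).
Hypothesis kappa_ge1 : 1 <= kappa.
Hypotheses (basis0 : is_basis A f0)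
  (coord0 : forall i j, `|coord A f0 (row i A) 0 j| <= 1).
Hypothesis FP : forall v, is_vertex A b v -> [/\ is_basis A (F v),
  forall j, F v j \in tight_set A b v &
  forall i j, `|coord A (F v) (row i A) 0 j| <= kappa].

Let N : R := n%:R.
Let N_ge1 : 1 <= N. Proof. by rewrite ler1n. Qed.

(* In the second alternative the objective is rescaled by alpha / beta, so that X
   is moved instead of c. *)
Lemma opt_shift (alpha beta rho theta : R) c X v (z : 'rV[R]_n) :
  is_vertex A b v -> gauge_le A N c -> gauge_le A rho X ->
  (forall j, theta <= z 0 j) -> 0 <= alpha <= beta ->
  (beta - alpha) * (kappa * N) <= theta \/
    0 < alpha /\ (1 - alpha / beta) * (kappa * rho) <= theta ->
  opt A b (beta *: c + X) v ->
  opt A b (alpha *: c + X + z *m rowsub (F v) A) v.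
Proof.
move=> vv gc gX zt /andP[a0 ab] + ob.
have [uF tF cF] := FP vv; have Pv : poly A b v by case/vertexP: vv.
have k0 : 0 <= kappa by apply: le_trans kappa_ge1.
case=> [h|[ap h]].
  have -> : alpha *: c + X + z *m rowsub (F v) A =
      (beta *: c + X) + (z *m rowsub (F v) A - (beta - alpha) *: c).
    by move: (z *m _) => Z; apply/rowP => j; rewrite !mxE; ring.
  apply: optD ob _; apply: (basis_opt uF Pv tF) => j.
  have := gauge_coord j k0 cF gc; rewrite ler_norml => /andP[_ cj].
  rewrite {1}/coord mulmxBl -/(coord _ _ _) -scalemxAl -/(coord A (F v) c).
  rewrite mul_rowsubK //; move: (coord A (F v) c) cj => w cj; rewrite !mxE.
  have := zt j; nra.
have bp : 0 < beta by apply: lt_le_trans ab.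
have r1 : alpha / beta <= 1 by rewrite ler_pdivrMr // mul1r.
have -> : alpha *: c + X + z *m rowsub (F v) A =
    (alpha / beta) *: (beta *: c + X) +
    (z *m rowsub (F v) A + (1 - alpha / beta) *: X).
  by move: (z *m _) => Z; apply/rowP => j; rewrite !mxE; field; rewrite gt_eqF.
apply: optD; first by apply: optZ ob; rewrite divr_ge0 // ltW.
apply: (basis_opt uF Pv tF) => j.
have := gauge_coord j k0 cF gX; rewrite ler_norml => /andP[cj _].
rewrite {1}/coord mulmxDl -/(coord _ _ _) -scalemxAl -/(coord A (F v) X).
rewrite mul_rowsubK //; move: (coord A (F v) X) cj => w cj; rewrite !mxE.
have := zt j; nra.
Qed.

Lemma chain_walk (al : nat -> R) c X M u : (forall j, 0 <= al j) ->
  bounded A b c -> bounded A b X ->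
  is_vertex A b u -> opt A b (al M *: c + X) u ->
  exists l w, [/\ is_vertex A b w, opt A b (al 0%N *: c + X) w, walk A b l u w &
    (l <= \sum_(j < M) #|hits A b (al j.+1 *: c + X) (al j *: c + X)|)%N].
Proof.
move=> al0 bc bX; elim: M u => [|M IH] u vu ou.
  by exists 0%N, u; split=> //; exact: walk0.
have [|k [w [vw ow uw kh]]] := segment_walk rankA (q := al M *: c + X) vu ou.
  exact/boundedD/bX/boundedZ.
have [l [x [vx ox wx lh]]] := IH w vw ow.
exists (k + l)%N, x; split=> //; first exact: walk_cat uw wx.
by rewrite big_ord_recr /= addnC leq_add.
Qed.

(** For each vertex [v], a fixed lattice vector deep in its cone shifts every lattice point whose
    segment meets the cone to one whose endpoint, at [alpha], lies in it. The shift is injective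
    into the ball of radius [rho'], where each point is counted for at most one vertex. *)
Lemma hit_count (rho rho' theta alpha beta : R) L c x0 :
  0 <= rho -> gauge_le A N c -> gauge_le A 1 x0 -> 0 <= alpha <= beta ->
  (beta - alpha) * (kappa * N) <= theta \/
    0 < alpha /\ (1 - alpha / beta) * (kappa * (rho + 1)) <= theta ->
  N * kappa <= theta / 2 -> rho + 2 * theta * N <= rho' -> rho' <= L%:R ->
  (forall (k : {ffun 'I_n -> 'I_(L.*2.+1)}) v w, is_vertex A b v -> is_vertex A b w ->
     opt A b (alpha *: c + (x0 + lattice_pt A f0 k)) v ->
     opt A b (alpha *: c + (x0 + lattice_pt A f0 k)) w -> v = w) ->
  (\sum_(k in lattice_ball A f0 rho L)
     #|hits A b (beta *: c + (x0 + lattice_pt A f0 k))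
                (alpha *: c + (x0 + lattice_pt A f0 k))|
   <= #|lattice_ball A f0 rho' L|)%N.
Proof.
move=> rho0 gc g0 ab small Nk rho_rho' rho'L uniq.
have k0 : 0 <= kappa by apply: le_trans kappa_ge1.
have th0 : 0 <= theta.
  by have : 0 <= N * kappa; [rewrite mulr_ge0 // (le_trans ler01 N_ge1)|lra].
pose X k := x0 + @lattice_pt R m n A f0 L k.
(* The cones containing the endpoint for [k]; by genericity there is at most one. *)
pose opts k := [set I | `[< exists v, [/\ is_vertex A b v, tight_set A b v = I &
  opt A b (alpha *: c + X k) v] >]].
apply: (@leq_trans (\sum_(k in lattice_ball A f0 rho' L) #|opts k|)%N); last first.
  rewrite -sum1_card; apply: leq_sum => k _; apply/card_le1_eqP => I J.
  rewrite inE => /asboolP[v [vv <- ov]]; rewrite inE => /asboolP[w [vw <- ow]].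
  by rewrite (uniq k v w).
rewrite !sum_card_exchange; apply: leq_sum => I _.
set S := [set k in _ | _]; set S' := [set k in _ | _].
have [[v [vv vI]]|nv] := pselect (exists v, is_vertex A b v /\ tight_set A b v = I);
  last first.
  rewrite (_ : S = finset.set0) ?cards0 //; apply/setP => k; rewrite !inE.
  by apply/negP => /andP[_ /asboolP[v [t [vv vI _ _]]]]; apply: nv; exists v.
have [uF tF cF] := FP vv.
have [e [z [ez zt]]] := lattice_direction basis0 uF k0 cF Nk.
have gz : gauge_le A (2 * theta * N) (z *m rowsub (F v) A).
  apply: gauge_basis => [j|].
    by have /andP[+ _] := zt j; apply: le_trans.
  rewrite /N -[n in leRHS]card_ord mulr_natr -sumr_const; apply: ler_sum => j _.
  by have /andP[] := zt j.
(* Translation by the lattice vector; on [S] the search succeeds, so the default [k] does not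
   occur. *)
pose g (k : {ffun 'I_n -> 'I_(L.*2.+1)}) := odflt k
  [pick k' | lattice_pt A f0 k' == lattice_pt A f0 k + z *m rowsub (F v) A].
have gP k : k \in S -> lattice_pt A f0 (g k) = lattice_pt A f0 k + z *m rowsub (F v) A /\
    gauge_le A rho' (lattice_pt A f0 (g k)).
  rewrite inE => /andP[+ _]; rewrite inE => /asboolP gk.
  have gk' := gauge_leW rho_rho' (gauge_leD gk gz).
  have [|k' k'E] := @lattice_pt_shift R m n A f0 basis0 coord0 L k e rho' rho'L.
    by rewrite ez.
  rewrite /g; case: pickP => [k'' /eqP -> //|/(_ k')].
  by rewrite k'E ez eqxx.
rewrite -(@card_in_imset _ _ g S).
  apply/subset_leq_card/fintype.subsetP => _ /imsetP[k kS ->].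
  have [gE gg] := gP _ kS; move: kS; rewrite inE => /andP[+].
  rewrite inE => /asboolP gk; rewrite inE => /asboolP[w [t [vw wI /andP[t0 t1] ow]]].
  have wv : w = v by apply: (tight_set_inj vw vv); rewrite wI vI.
  rewrite wv in ow.
  rewrite inE; apply/andP; split; first by rewrite inE; apply/asboolP.
  rewrite inE; apply/asboolP; exists v; split=> //; rewrite /X gE !addrA.
  rewrite -(addrA (alpha *: c)).
  have gX : gauge_le A (rho + 1) (X k) by rewrite addrC; apply: gauge_leD.
  (* The parameter at which the segment meets the cone; it is at most [beta], so the smallness
     condition carries over. *)
  pose beta' := beta + t * (alpha - beta).
  have ab' : 0 <= alpha <= beta'.
    by move: ab => /andP[a0 ab]; apply/andP; split=> //; rewrite /beta'; nra.
  apply: (opt_shift (theta := theta) vv gc gX _ ab').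
  - by move=> j; have /andP[] := zt j.
  - case: small => [h|[ap h]]; [left|right; split=> //].
      apply: le_trans h; rewrite ler_wpM2r ?mulr_ge0 ?(le_trans ler01 N_ge1) //.
      by move: ab; rewrite /beta' => /andP[_ ab]; nra.
    apply: le_trans h; rewrite ler_wpM2r //.
      by rewrite mulr_ge0 // addr_ge0.
    rewrite lerD2l lerN2 ler_pM2l // lef_pV2 ?posrE.
    - by move: ab; rewrite /beta' => /andP[_ ab]; nra.
    - by move: ab => /andP[_]; apply: lt_le_trans.
    - by move: ab' => /andP[_]; apply: lt_le_trans.
  have -> : beta' *: c + X k = beta *: c + X k + t *: (alpha *: c + X k - (beta *: c + X k)).
    rewrite opprD addrACA subrr addr0 -scalerBl scalerA addrAC -scalerDl //.
  exact: ow.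
move=> k k' /gP[kE _] /gP[k'E _] e1; apply: (lattice_pt_inj basis0).
by apply: (addIr (z *m rowsub (F v) A)); rewrite -kE -k'E e1.
Qed.

(** Two distinct vertices tie only if the objective lies on a hyperplane. A point of the moment
    curve avoids these finitely many hyperplanes, and a parameter below [1 / n] keeps its gauge at
    most 1. *)
Lemma generic_offset (al : nat -> R) (c : bool -> 'rV[R]_n) L M : exists2 x0,
  gauge_le A 1 x0 & forall s j (k : {ffun 'I_n -> 'I_(L.*2.+1)}) v w, (j <= M)%N ->
    is_vertex A b v -> is_vertex A b w ->
    opt A b (al j *: c s + (x0 + lattice_pt A f0 k)) v ->
    opt A b (al j *: c s + (x0 + lattice_pt A f0 k)) w -> v = w.
Proof.
pose idx := ({ffun 'I_n -> 'I_(L.*2.+1)} * 'I_M.+1 * bool * {set 'I_m} * {set 'I_m})%type.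
pose y (t : idx) := vert A b t.1.2 - vert A b t.2.
have [||s [s0 s1 sP]] := @moment_curve_avoids R n idx [pred t | y t != 0]
  (fun t => dot (al t.1.1.1.2 *: c t.1.1.2 + lattice_pt A f0 t.1.1.1.1) (y t))
  (fun t j => dot (row (f0 j) A) (y t)) N^-1.
- by rewrite invr_gt0 (lt_le_trans ltr01 N_ge1).
- move=> t /eqP yt; apply: contrapT => nj; apply: yt; apply: (basis_ker basis0) => j.
  by apply/eqP/negPn/negP => jn; apply: nj; exists j.
have sN : s * N <= 1.
  by rewrite -ler_pdivlMr ?(lt_le_trans ltr01 N_ge1) // mul1r ltW.
have s_le1 : s <= 1 by apply: le_trans sN; rewrite ler_peMr ?(ltW s0).
pose x0 := (\row_(j < n) s ^+ j.+1) *m rowsub f0 A; exists x0.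
  apply: gauge_basis => [j|]; first by rewrite mxE exprn_ge0 // ltW.
  apply: le_trans sN; rewrite /N -[n in leRHS]card_ord mulr_natr -sumr_const.
  apply: ler_sum => j _; rewrite mxE exprS ler_piMr ?(ltW s0) //.
  by apply: exprn_ile1; rewrite // ltW.
move=> e j k v w jM vv vw ov ow; apply/eqP; rewrite -subr_eq0; apply: contraT => vw0.
have := sP (k, Ordinal (jM : (j < M.+1)%N), e, tight_set A b v, tight_set A b w).
rewrite /y /= !vertK // => /(_ vw0) /eqP; case.
have : dot (al j *: c e + (x0 + lattice_pt A f0 k)) (v - w) = 0.
  by rewrite dotDr dotNr (dot_opt ov ow) subrr.
rewrite (addrC x0) addrA dotDl => h; rewrite -[RHS]h; congr (_ + _).
rewrite /x0 mul_rowsub dot_suml; apply: eq_bigr => l _.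
by rewrite dotZl mxE mulrC.
Qed.

(** Two paths of [M.+1] segments, each segment meeting at most 3 cones on average over the lattice
    ball, give [6 * M.+1] for some lattice point. *)
Lemma short_walk M u v : is_vertex A b u -> is_vertex A b v ->
  8 * N ^+ 3 * kappa ^+ 2 <= (1 + (8 * N ^+ 2 * kappa)^-1) ^+ M ->
  exists2 l, walk A b l u v & (l <= 6 * M.+1)%N.
Proof.
move=> vu vv; set a := _^-1 => aM.
have Np : 0 < N := lt_le_trans ltr01 N_ge1.
have kp : 0 < kappa := lt_le_trans ltr01 kappa_ge1.
have a0 : 0 < a by rewrite invr_gt0 !mulr_gt0 ?exprn_gt0.
have c1 : 1 <= 8 * N ^+ 3 * kappa.
  by rewrite -mulrA mulr_ege1 ?mulr_ege1 ?exprn_ege1 //; lra.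
have [|rho [L [rho_ge rho'L growth]]] :=
  @lattice_ball_growth R m n A f0 n_gt0 (8 * N ^+ 3 * kappa).
  exact: c1.
rewrite -/N in rho'L growth; set rho' := rho * _ in rho'L growth.
have rho_ge1 : 1 <= rho by apply: le_trans rho_ge.
(* [theta] makes [rho + 2 * theta * N] equal to [rho']; [a1] makes the first segment exactly short
   enough to be moved in [c], and [a] does so for the later ones, which move [X]. *)
pose theta := rho / (4 * N ^+ 2); pose a1 := rho / (4 * N ^+ 3 * kappa).
pose al j := if j is j'.+1 then a1 * (1 + a) ^+ j' else 0.
have a1p : 0 < a1 by rewrite divr_gt0 ?mulr_gt0 ?exprn_gt0 // (lt_le_trans ltr01).
have alS j : 0 < al j.+1 by rewrite mulr_gt0 ?exprn_gt0 // addr_gt0.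
have al0 j : 0 <= al j by case: j => // j; apply: ltW.
have al_mono j : 0 <= al j <= al j.+1.
  rewrite al0; case: j => [|j]; first by rewrite ltW.
  by rewrite /= ler_pM2l // exprSr ler_peMr ?exprn_ge0 ?addr_ge0 ?(ltW a0) //; lra.
have step_small j : (al j.+1 - al j) * (kappa * N) <= theta \/
    0 < al j /\ (1 - al j / al j.+1) * (kappa * (rho + 1)) <= theta.
  case: j => [|j]; [left|right; split=> //].
    rewrite /= expr0 mulr1 subr0 le_eqVlt; apply/orP; left; apply/eqP.
    by rewrite /a1 /theta; field; rewrite !gt_eqF.
  have -> : al j.+1 / al j.+2 = (1 + a)^-1.
    rewrite /= exprSr; field; rewrite !gt_eqF ?exprn_gt0 ?addr_gt0 //.
  have h1 : 1 - (1 + a)^-1 <= a.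
    have -> : 1 - (1 + a)^-1 = a * (1 + a)^-1 by field; rewrite gt_eqF ?addr_gt0.
    by rewrite ler_piMr ?(ltW a0) // invf_le1 ?addr_gt0 //; lra.
  have -> : theta = a * (kappa * (2 * rho)) by rewrite /theta /a; field; rewrite !gt_eqF.
  by apply: ler_pM => //; [rewrite subr_ge0 invf_le1 ?addr_gt0 //; lra|
    rewrite mulr_ge0 ?(ltW kp) //; lra|rewrite ler_pM2l //; lra].
have Nk : N * kappa <= theta / 2.
  have -> : theta / 2 = rho / (8 * N ^+ 2) by rewrite /theta; field; rewrite gt_eqF.
  rewrite ler_pdivlMr ?mulr_gt0 ?exprn_gt0 //.
  by apply: le_trans rho_ge; rewrite le_eqVlt; apply/orP; left; apply/eqP; ring.
have rr : rho + 2 * theta * N <= rho'.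
  rewrite le_eqVlt; apply/orP; left; apply/eqP.
  by rewrite /rho' /theta; field; rewrite gt_eqF.
pose c (s : bool) := (const_mx 1 : 'rV[R]_n) *m rowsub (F (if s then u else v)) A.
have gc s : gauge_le A N (c s).
  apply: gauge_basis => [j|]; first by rewrite mxE.
  by under eq_bigr do rewrite mxE; rewrite sumr_const card_ord.
have [x0 g0 uniq] := generic_offset al c L M.
pose X k := x0 + @lattice_pt R m n A f0 L k.
pose h s j k := #|hits A b (al j.+1 *: c s + X k) (al j *: c s + X k)|.
have [||k kS hk] := @exists_le_average _ (lattice_ball A f0 rho L)
  (fun k => \sum_(s : bool) \sum_(j < M.+1) h s j k)%N (6 * M.+1)%N.
- by apply: lattice_ball_gt0; lra.
- rewrite exchange_big /=.
  apply: (@leq_trans (\sum_(s : bool) \sum_(j < M.+1) 3 * #|lattice_ball A f0 rho L|)%N).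
    apply: leq_sum => s _; rewrite exchange_big /=; apply: leq_sum => j _.
    apply: leq_trans growth; apply: (hit_count (theta := theta)) => //.
    + by lra.
    + by move=> k x w vx vw; apply: uniq; rewrite // -ltnS.
  by rewrite !sum_nat_const card_bool card_ord !mulnA leq_mul // mulnAC.
have gk : gauge_le A (1 + rho) (X k).
  by apply: gauge_leD => //; move: kS; rewrite inE => /asboolP.
have start s x : x = (if s then u else v) -> is_vertex A b x ->
    exists l w, [/\ is_vertex A b w, opt A b (al 0%N *: c s + X k) w, walk A b l x w &
      (l <= \sum_(j < M.+1) h s j k)%N].
  move=> xE vx; apply: chain_walk => //.
  - exact: gauge_bounded (gc s).
  - exact: gauge_bounded gk.
  have [uF tF cF] := FP vx.
  apply: (basis_opt uF _ tF) => [|j]; first by case/vertexP: vx.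
  rewrite /coord mulmxDl -scalemxAl -/(coord _ _ (c s)) -/(coord _ _ (X k)).
  rewrite /c -xE mul_rowsubK //.
  have := gauge_coord j (ltW kp) cF gk; rewrite ler_norml => /andP[+ _].
  move: (coord A (F x) (X k)) => w; rewrite !mxE mulr1 => hw.
  (* In the basis at [x] all coordinates of [c s] are 1 and those of [X k] are at least
     [- 2 * kappa * rho], so this factor of [c s] makes [x] optimal at the start. *)
  have : 2 * kappa * rho <= a1 * (1 + a) ^+ M.
    apply: le_trans (ler_wpM2l (ltW a1p) aM).
    rewrite le_eqVlt; apply/orP; left; apply/eqP; rewrite /a1; field.
    by rewrite !gt_eqF.
  have kr : kappa * (1 + rho) <= kappa * (2 * rho) by rewrite ler_pM2l //; lra.
  by rewrite /=; lra.
have [l [w [vw ow uw lh]]] := start true u erefl vu.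
have [l' [w' [vw' ow' uw' lh']]] := start false v erefl vv.
have ww' : w = w'.
  (* Both paths end at the objective [X k], since [al 0] is 0, and its optimal vertex is unique. *)
  apply: (uniq true 0%N k) => //; move: ow'; rewrite /= !scale0r //.
exists (l + l')%N; first by apply: walk_cat uw _; apply: walk_sym; rewrite ww'.
by apply: leq_trans hk; rewrite big_bool leq_add.
Qed.

End ShortWalk.

(** * Logarithmic estimates and the final bound *)

Lemma ln1D_ge_half (R : realType) (a : R) : 0 <= a <= 1 -> a / 2 <= ln (1 + a).
Proof.
move=> /andP[a0 a1]; have p : 0 < 1 + a by lra.
(* The bound [ln (1 + x) <= x] at this [x] concerns the inverse of [1 + a]. *)
have : ln (1 + - (a / (1 + a))) <= - (a / (1 + a)).
  apply: le_ln1Dx; rewrite ltrN2 ltr_pdivrMr //; lra.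
rewrite (_ : 1 + - (a / (1 + a)) = (1 + a)^-1); last by field; rewrite gt_eqF.
rewrite lnV ?posrE // lerN2; apply: le_trans.
rewrite ler_pdivlMr // mulrAC ler_pdivrMr //; nra.
Qed.

(** About [ln D / ln (1 + a)], hence [O(N ^+ 2 * kappa * ln D)], steps suffice. With
    [Q = N * kappa], [D] is at most [8 * Q ^+ 3], so [ln D <= 6 * ln Q] for [Q >= 2]; for smaller
    [Q] everything is bounded. *)
Lemma steps_bound (R : realType) (N kappa : R) : 1 <= N -> 1 <= kappa ->
  exists2 M : nat, 8 * N ^+ 3 * kappa ^+ 2 <= (1 + (8 * N ^+ 2 * kappa)^-1) ^+ M &
    6 * M.+1%:R <= 2400 * Num.max 1 (N ^+ 3 * kappa * ln (N * kappa)).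
Proof.
move=> N1 k1; set a := _^-1; set D := 8 * N ^+ 3 * _.
have Np : 0 < N by apply: lt_le_trans N1.
have kp : 0 < kappa by apply: lt_le_trans k1.
have D1 : 1 <= D.
  by rewrite /D -mulrA mulr_ege1 ?mulr_ege1 ?exprn_ege1 //; lra.
have N2k : 1 <= N ^+ 2 * kappa by rewrite mulr_ege1 ?exprn_ege1.
have a0 : 0 < a by rewrite invr_gt0 !mulr_gt0 ?exprn_gt0.
have a1 : a <= 1 by rewrite invf_le1 -?mulrA //; lra.
have la : a / 2 <= ln (1 + a) by apply: ln1D_ge_half; rewrite ltW.
have lap : 0 < ln (1 + a) by apply: lt_le_trans la; rewrite divr_gt0.
have lD : 0 <= ln D by apply: ln_ge0.
have q0 : 0 <= ln D / ln (1 + a) by rewrite divr_ge0 // ltW.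
have /andP[Mlo Mhi] := truncn_itv q0; exists (Num.truncn (ln D / ln (1 + a))).+1.
  rewrite -ler_ln ?posrE ?exprn_gt0 ?addr_gt0 ?(lt_le_trans ltr01 D1) //.
  rewrite lnXn ?addr_gt0 // -[leRHS]mulr_natl -ler_pdivrMr //.
  exact: ltW.
have Mle : (Num.truncn (ln D / ln (1 + a)))%:R <= 16 * (N ^+ 2 * kappa) * ln D.
  apply: le_trans Mlo _; rewrite mulrC ler_wpM2r //.
  have -> : 16 * (N ^+ 2 * kappa) = (a / 2)^-1 by rewrite /a; field; rewrite !gt_eqF.
  by rewrite lef_pV2 ?posrE // divr_gt0.
set Q := N * kappa; have Qp : 0 < Q by rewrite mulr_gt0.
have NQ : N <= Q by rewrite ler_peMr // ltW.
have DQ : D <= 8 * Q ^+ 3.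
  rewrite /D /Q exprMn -mulrA ler_pM2l // ler_pM2l ?exprn_gt0 //.
  by rewrite [leRHS]exprSr ler_peMr ?exprn_ge0 // ltW.
have l2 : 1 / 2 <= ln 2 :> R by have := @ln1D_ge_half R 1; rewrite ler01 lexx => /(_ isT).
have l2' : ln 2 <= 1 :> R by have := @le_ln1Dx R 1; apply; lra.
rewrite -[_.+2%:R]natr1 -[_.+1%:R]natr1.
have [Q2|Q2] := leP 2 Q.
  have lDQ : ln D <= 6 * ln Q.
    rewrite mulr_natl -lnXn // ler_ln ?posrE ?exprn_gt0 ?(lt_le_trans ltr01 D1) //.
    apply: le_trans DQ _; rewrite (exprD Q 3 3) ler_wpM2r ?exprn_ge0 ?(ltW Qp) //.
    have -> : (8 : R) = 2 ^+ 3 by ring.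
    by apply: lerXn2r; rewrite ?nnegrE ?(ltW Qp) //; lra.
  have lQ : 1 / 2 <= ln Q by apply: le_trans l2 _; rewrite ler_ln ?posrE.
  have N3 : N ^+ 2 * kappa <= N ^+ 3 * kappa.
    by rewrite ler_pM2r // [leRHS]exprSr ler_peMr ?exprn_ge0 // ltW.
  have h1 : N ^+ 2 * kappa * ln D <= N ^+ 3 * kappa * (6 * ln Q).
    by apply: ler_pM => //; lra.
  have h2 : 1 * (1 / 2) <= N ^+ 3 * kappa * ln Q by apply: ler_pM => //; lra.
  have h3 : N ^+ 3 * kappa * ln Q <= Num.max 1 (N ^+ 3 * kappa * ln Q).
    by rewrite le_max lexx orbT.
  by move: Mle; rewrite -mulrA; lra.
(* For [Q < 2] the bound is [6 * (16 * 4 * 6 + 2) = 2316], which accounts for the constant 2400. *)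
have lD6 : ln D <= 6.
  apply: (@le_trans _ _ (ln (2 ^+ 6))); last by rewrite lnXn // -[_ *+ 6]mulr_natl; lra.
  rewrite ler_ln ?posrE ?exprn_gt0 ?(lt_le_trans ltr01 D1) //.
  apply: le_trans DQ _; rewrite (exprD 2 3 3).
  have -> : (2 ^+ 3 : R) = 8 by ring.
  rewrite ler_pM2l //.
  have -> : (8 : R) = 2 ^+ 3 by ring.
  by apply: lerXn2r; rewrite ?nnegrE ?(ltW Qp) //; lra.
have h4 : N ^+ 2 * kappa <= 4.
  apply: (@le_trans _ _ (Q * Q)).
    by rewrite expr2 -mulrA; apply: ler_pM; rewrite ?(ltW Np) ?(ltW Qp).
  have -> : (4 : R) = 2 * 2 by ring.
  by apply: ler_pM; rewrite ?(ltW Qp) // ltW.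
have h5 : N ^+ 2 * kappa * ln D <= 4 * 6 by apply: ler_pM => //; lra.
have h6 : 1 <= Num.max 1 (N ^+ 3 * kappa * ln Q) by rewrite le_max lexx.
by move: Mle; rewrite -mulrA; lra.
Qed.

(** The maximum with 1 covers small [n * kappa]: for a segment with rows 1 and -1 the logarithm is 0
    while the diameter is 1. *)
Theorem theorem2 :
  exists C : nat,
  forall (R : realType) (m n : nat) (A : 'M[R]_(m, n)) (b : 'cV[R]_m),
    \rank A = n ->
    pointed A b ->
    full_dimensional A b ->
    all_facet_defining A b ->
    diam_le A b
      (C%:R * Num.max 1
         (n%:R ^+ 3 * (Delta A / Delta_min A b)
            * ln (n%:R * (Delta A / Delta_min A b)))).
Proof.
exists 2400%N => R m n A b rankA ptd _ _ u v vu vv.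
have [n0|n_gt0] := posnP n.
  subst n; exists 0%N; split.
    by rewrite (flatmx0 u) (flatmx0 v); apply: walk0.
  by rewrite mulr_ge0 ?ler0n // le_max ler01.
have [dmin0 dmin_le [f0 basis0 det0] bases] := vertex_large_basis rankA ptd.
set kappa := Delta A / Delta_min A b.
have D0 : 0 < Delta A by apply: lt_le_trans dmin_le.
have k1 : 1 <= kappa by rewrite ler_pdivlMr ?mul1r.
have /boolp.choice[F FP] : forall x, exists f : {ffun 'I_n -> 'I_m},
    is_vertex A b x -> [/\ is_basis A f, forall j, f j \in tight_set A b x &
      forall i j, `|coord A f (row i A) 0 j| <= kappa].
  move=> x; have [vx|nx] := pselect (is_vertex A b x); last by exists f0.
  have [f [uf tf df]] := bases x vx; exists f => _; split=> // i j.
  apply: le_trans (coord_row_le i j uf) _.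
  rewrite ler_pM2l // lef_pV2 ?posrE //; exact: lt_le_trans df.
have coord0 i j : `|coord A f0 (row i A) 0 j| <= 1.
  by have := coord_row_le i j basis0; rewrite det0 divff ?gt_eqF.
have N1 : 1 <= (n%:R : R) by rewrite ler1n.
have [M MP Mle] := steps_bound N1 k1.
have [l wl lM] := short_walk n_gt0 rankA k1 basis0 coord0 FP vu vv MP.
exists l; split=> //; apply: le_trans Mle.
by rewrite -natrM ler_nat.
Qed.
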